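(* Let $e\ge2$ and $n\ge0$ be integers and let $p$ be either $0$ or a prime which is equal to $e$ or coprime to $e$. Let $\lambda\in\mathsf{Par}_{\le2}(n)$ and $\mu\in\mathsf{RPar}_{e,\le2}(n)$ with $\mathsf{Std}_{e,p,\mu}(\lambda)\ne\varnothing$. (i) The map $\operatorname{reg}'_{e,p,\lambda,\mu}\colon\mathsf{Std}_{e,p,\mu}(\lambda)\to\mathsf{DStd}_{e,p}(\mu)$ is a bijection. (ii) For all $\mathtt t\in\mathsf{Std}_{e,p,\mu}(\lambda)$, the tableaux $\operatorname{reg}'_{e,p,\lambda,\mu}(\mathtt t)$ and $\mathtt t$ have the same residue sequence: $\boldsymbol i^{\operatorname{reg}'_{e,p,\lambda,\mu}(\mathtt t)}=\boldsymbol i^{\mathtt t}$. (iii) $\operatorname{ch}_q\mathsf{Std}_{e,p,\mu}(\lambda)=q^{r_{e,p,\lambda,\mu}}\operatorname{ch}_q\mathsf{DStd}_{e,p}(\mu)$.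
   Context: **Partitions and tableaux.** $I=\mathbb Z/e\mathbb Z$. $\mathsf{Par}_{\le2}(n)$ is the set of partitions of $n$ with all parts at most $2$; $\mathsf{RPar}_{e,\le2}(n)$ is the subset of $e$-restricted ones, i.e. with $\lambda_r-\lambda_{r+1}<e$ for all $r\ge1$ (where $\lambda_r:=0$ beyond the last part). The Young diagram is $[\lambda]=\{(a,b)\mid 1\le b\le\lambda_a\}$ ($a$ = row, numbered from the top; $b$ = column). A standard $\lambda$-tableau is a bijection $\mathtt t\colon\{1,\dots,n\}\to[\lambda]$ ($\mathtt t(r)$ is the node containing $r$) with entries increasing along rows and down columns; $\mathsf{Std}(\lambda)$ is the set of these, $\mathsf{Std}_{\le2}(n)=\bigcup_{\lambda\in\mathsf{Par}_{\le2}(n)}\mathsf{Std}(\lambda)$. The residue of $(a,b)$ is $b-a+e\mathbb Z$ and $\boldsymbol i^{\mathtt t}=(\operatorname{res}\mathtt t(1),\dots,\operatorname{res}\mathtt t(n))\in I^n$. Degree: a node is addable (removable) for $\lambda$ if adding it to (removing it from) $[\lambda]$ gives a Young diagram of a partition; $(a,b)$ is below $(a',b')$ if $a>a'$. For a removable node $A$ of residue $i$, $d_A(\lambda)$ is the number of addable nodes of residue $i$ below $A$ minus the number of removable nodes of residue $i$ below $A$. Put $\deg_e(\mathtt t)=0$ if $n=0$, and $\deg_e(\mathtt t)=d_{\mathtt t(n)}(\lambda)+\deg_e(\mathtt t\!\downarrow_{n-1})$ otherwise, where $\mathtt t\!\downarrow_{m}$ is the restriction to $\{1,\dots,m\}$.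 For a finite set $\mathcal T$ of standard tableaux, $\operatorname{ch}_q\mathcal T=\sum_{\mathtt t\in\mathcal T}q^{\deg_e(\mathtt t)}\cdot\boldsymbol i^{\mathtt t}$ in the free $\mathbb Z[q,q^{-1}]$-module on $I^n$. **Regularisation.** Let $\mathsf P_n^+$ be the set of maps $\pi\colon\{0,\dots,n\}\to\mathbb Z_{\ge0}$ with $\pi(0)=0$ and $\pi(a+1)=\pi(a)\pm1$. For $\mathtt t\in\mathsf{Std}_{\le2}(n)$, $\pi_{\mathtt t}(a)$ is the number of elements of $\{1,\dots,a\}$ in column 1 of $\mathtt t$ minus the number in column 2; $\mathtt t\mapsto\pi_{\mathtt t}$ is a bijection $\mathsf{Std}_{\le2}(n)\to\mathsf P^+_n$, via which all maps on $\mathsf P^+_n$ below are transported to $\mathsf{Std}_{\le2}(n)$. For an integer $d\ge2$ define $\operatorname{reg}_d$ on $\mathsf P^+_n$: if $\pi$ takes no value of the form $md-1$ with $m\ge1$, then $\operatorname{reg}_d(\pi)=\pi$. Otherwise let $a$ be maximal such that $\pi(a)=md-1$ for some $m\ge 1$; if $\pi(n)\ge md-1$ then $\operatorname{reg}_d(\pi)=\pi$, and if $\pi(n)<md-1$ then $\operatorname{reg}_d(\pi)(b)=\pi(b)$ for $b\le a$ and $\operatorname{reg}_d(\pi)(b)=2(md-1)-\pi(b)$ for $b>a$. Let $r_e(\pi)=0$ if $\operatorname{reg}_e(\pi)=\pi$ and $1$ otherwise. If $p=0$, $\operatorname{reg}_{e,0}=\operatorname{reg}_e$. If $p>0$, $\operatorname{reg}_{e,p}$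 is defined recursively: if $\operatorname{reg}_{ep^z}(\pi)=\pi$ for all $z\ge0$ then $\operatorname{reg}_{e,p}(\pi)=\pi$; otherwise $\operatorname{reg}_{e,p}(\pi)=\operatorname{reg}_{e,p}(\operatorname{reg}_{ep^z}(\pi))$ with $z$ the largest non-negative integer such that $\operatorname{reg}_{ep^z}(\pi)\ne\pi$. The set $\{z_1>\dots>z_h\}$ of the successive integers $z$ used in this recursion is the regularisation set of $\pi$. Put $\mathsf{DStd}_{e,p}(\mu)=\{\mathtt t\in\mathsf{Std}(\mu)\mid\operatorname{reg}_{e,p}(\mathtt t)=\mathtt t\}$ and $\mathsf{Std}_{e,p,\mu}(\lambda)=\{\mathtt t\in\mathsf{Std}(\lambda)\mid\operatorname{reg}_{e,p}(\mathtt t)\text{ has shape }\mu\}$. Define $r_{e,p,\lambda,\mu}:=r_e(\mathtt t)$ for any $\mathtt t\in\mathsf{Std}_{e,p,\mu}(\lambda)$ (this does not depend on $\mathtt t$). **The map $\rho_Z$.** Let $Z=\{z_1>\dots>z_h\}$ be a finite subset of $\mathbb Z_{\ge0}$. If $p=0$, $\rho_Z$ is the identity on $\mathsf P^+_n$. If $p>0$ and $\eta\in\mathsf P^+_n$, let $B(\eta)=\{b_1<\dots<b_N\}$ be the set of $b\in\{0,\dots,n\}$ such that $\eta(b)=me-1$ for some $m\ge1$. For $1\le i\le h$ let $w_i$ be the maximal element of $\{0,\dots,n\}$ such that $\eta(w_i)=mp^{z_i}e-1$ for some $m\ge1$ ($w_i=0$ if there is none); set $w_0=0$ and $w_{h+1}=b_N$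 ($:=0$ if $B(\eta)=\varnothing$). Then $\rho_Z(\eta)\in\mathsf P^+_n$ agrees with $\eta$ on $[0,b_1]$ and on $[b_N,n]$ (everywhere if $B(\eta)=\varnothing$), and for $1\le k<N$: if $\eta(b_k)=\eta(b_{k+1})=me-1$ with $m\ge1$ and $[b_k,b_{k+1}]\subseteq[w_i,w_{i+1}]$ for some odd $i\in\{1,\dots,h\}$, then $\rho_Z(\eta)(c)=2(me-1)-\eta(c)$ for $c\in[b_k,b_{k+1}]$; otherwise $\rho_Z(\eta)$ agrees with $\eta$ on $[b_k,b_{k+1}]$. **The map $\operatorname{reg}'$.** All elements of $\mathsf{Std}_{e,p,\mu}(\lambda)$ have the same regularisation set $Z$ when $p>0$. Define $\operatorname{reg}'_{e,p,\lambda,\mu}(\mathtt t)=\rho_Z(\operatorname{reg}_{e,p}(\mathtt t))\in\mathsf{DStd}_{e,p}(\mu)$ for $\mathtt t\in\mathsf{Std}_{e,p,\mu}(\lambda)$ (so for $p=0$ it is the restriction of $\operatorname{reg}_e$). *)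

(* Defs.v *)
From HB Require Import structures.
From mathcomp Require Import all_boot all_order all_algebra.
Set Implicit Arguments.
Unset Strict Implicit.
Unset Printing Implicit Defensive.
Import Order.TTheory GRing.Theory Num.Theory.
Local Open Scope nat_scope.

(** Partitions are finite weakly decreasing sequences of positive integers;
    rows and columns of nodes are numbered from 1. *)

Definition node := (nat * nat)%type.

Definition is_part (la : seq nat) : bool := sorted geq la && (0 \notin la).

Definition Par2 (n : nat) (la : seq nat) : bool :=
  [&& is_part la, sumn la == n & all (fun x => x <= 2) la].

(* [nth 0] is 0 beyond the last part. *)
Definition restricted (e : nat) (la : seq nat) : Prop :=
  forall r : nat, nth 0 la r - nth 0 la r.+1 < e.

Definition RPar2 (e n : nat) (la : seq nat) : Prop :=
  Par2 n la /\ restricted e la.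

(* The Young diagram, as a duplicate-free list of nodes. *)
Definition nodes (la : seq nat) : seq node :=
  [seq (a, b) | a <- iota 1 (size la), b <- iota 1 (nth 0 la a.-1)].

(* Row lengths of a finite set of nodes, up to the last nonempty row. If the
   set is the Young diagram of a partition, then this is that partition. *)
Definition row_lengths (s : seq node) : seq nat :=
  [seq count (fun A : node => A.1 == a) s
     | a <- iota 1 (foldr maxn 0 [seq A.1 | A <- s])].

Definition is_diagram (s : seq node) : bool :=
  is_part (row_lengths s) && perm_eq s (nodes (row_lengths s)).

Definition addable (la : seq nat) (A : node) : bool :=
  (A \notin nodes la) && is_diagram (A :: nodes la).

Definition removable (la : seq nat) (A : node) : bool :=
  (A \in nodes la) && is_diagram (rem A (nodes la)).

(* Every addable node of a partition lies in this rectangle. *)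
Definition addables (la : seq nat) : seq node :=
  [seq A <- [seq (a, b) | a <- iota 1 (size la).+1,
                          b <- iota 1 (head 0 la).+1] | addable la A].

Definition removables (la : seq nat) : seq node :=
  [seq A <- nodes la | removable la A].

(** The tableau [t] is the list [t(1); ...; t(n)], so that [take m t] is its
    restriction to {1, ..., m} and [index A t] is one less than the entry of the
    node [A]. *)

Definition tableau := seq node.

Definition standard (t : tableau) : bool :=
  all (fun A : node => all (fun B : node =>
    ((A.1 == B.1) && (A.2 < B.2)) || ((A.2 == B.2) && (A.1 < B.1)) ==>
    (index A t < index B t)) t) t.

(* The bijections {1, ..., n} -> [la] are the orderings of [nodes la]. *)
Definition Std (la : seq nat) : seq tableau :=
  [seq t <- permutations (nodes la) | standard t].

Lemma mem_Std (la : seq nat) (t : tableau) :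
  (t \in Std la) = perm_eq t (nodes la) && standard t.
Proof. by rewrite mem_filter mem_permutations andbC. Qed.

Lemma Std_uniq (la : seq nat) : uniq (Std la).
Proof. exact/filter_uniq/permutations_uniq. Qed.

(* ['Z_e] is Z/eZ when 2 <= e. *)
Definition res (e : nat) (A : node) : 'Z_e := (A.2%:R - A.1%:R)%R.

Definition res_seq (e : nat) (t : tableau) : seq 'Z_e :=
  [seq res e A | A <- t].

Definition node_deg (e : nat) (la : seq nat) (A : node) : int :=
  let counted := fun B : node => (A.1 < B.1) && (res e B == res e A) in
  ((count counted (addables la))%:Z - (count counted (removables la))%:Z)%R.

(* The degree of the restriction of [t] to {1, ..., m}. *)
Fixpoint deg_upto (e : nat) (t : tableau) (m : nat) : int :=
  if m is m'.+1 then
    (node_deg e (row_lengths (take m t)) (nth (0, 0) t m') + deg_upto e t m')%R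
  else 0%R.

Definition deg (e : nat) (t : tableau) : int := deg_upto e t (size t).

(** Z[q, q^-1] is identified with its image in the fraction field of Z[q], and
    the free module on I^n with the functions from I^n to scalars: the basis
    element [i] is the indicator function of [i]. *)

Definition qfield := {fraction {poly int}}.

Definition q : qfield := tofrac 'X%R.

Definition charmod (e n : nat) := {ffun n.-tuple 'Z_e -> qfield^o}.

Definition basis_elt (e n : nat) (i : seq 'Z_e) : charmod e n :=
  [ffun j : n.-tuple 'Z_e => ((val j == i)%:R)%R].

Definition ch (e n : nat) (T : seq tableau) : charmod e n :=
  (\sum_(t <- T) (q ^ deg e t) *: basis_elt n (res_seq e t))%R.

(** The path [pi : {0, ..., n} -> nat] is the list [pi(0); ...; pi(n)]. *)

Definition path_of (t : tableau) : seq nat :=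
  mkseq (fun a => count (fun A : node => A.2 == 1) (take a t)
                  - count (fun A : node => A.2 == 2) (take a t)) (size t).+1.

(* The inverse of [path_of]: each entry is placed at the bottom of column 1 or
   of column 2, according to whether the path goes up or down at that step. *)
Definition tab_of (pi : seq nat) : tableau :=
  let up := fun s => nth 0 pi s < nth 0 pi s.+1 in
  mkseq (fun r => if up r then (count up (iota 0 r.+1), 1)
                  else (count (predC up) (iota 0 r.+1), 2)) (size pi).-1.

(* The increasing list of the [b] with [pi(b) = m * d - 1] for some [m >= 1],
   that is, with [pi(b) + 1] divisible by [d]. *)
Definition walls (d : nat) (pi : seq nat) : seq nat :=
  [seq b <- iota 0 (size pi) | d %| (nth 0 pi b).+1].

(* The truncated subtraction is exact on paths: after its last visit to a wall,
   a path ending below this wall stays below it. *)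
Definition reg (d : nat) (pi : seq nat) : seq nat :=
  if walls d pi is [::] then pi else
  let a := last 0 (walls d pi) in
  if nth 0 pi a <= last 0 pi then pi else
  mkseq (fun b => if b <= a then nth 0 pi b else 2 * nth 0 pi a - nth 0 pi b)
        (size pi).

Definition r_path (e : nat) (pi : seq nat) : nat :=
  if reg e pi == pi then 0 else 1.

(* For [p > 1], the successive [z] used in the recursion, and its result. A path
   of length [n] has values at most [n], so only [z <= n] can satisfy
   [reg (e * p ^ z) pi <> pi]. Each step increases the last value of the path,
   so [n.+1] steps always reach the end of the recursion. *)
Fixpoint reg_rec (e p fuel : nat) (pi : seq nat) : seq nat * seq nat :=
  if fuel is fuel'.+1 then
    let zs := [seq z <- iota 0 (size pi) | reg (e * p ^ z) pi != pi] in
    if zs is [::] then ([::], pi) else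
    let z := last 0 zs in
    let r := reg_rec e p fuel' (reg (e * p ^ z) pi) in
    (z :: r.1, r.2)
  else ([::], pi).

Definition reg_ep (e p : nat) (pi : seq nat) : seq nat :=
  if p == 0 then reg e pi else (reg_rec e p (size pi) pi).2.

(* The regularisation set, listed in decreasing order (only used if [p > 0]). *)
Definition reg_set (e p : nat) (pi : seq nat) : seq nat :=
  (reg_rec e p (size pi) pi).1.

(* [Z] lists a finite set in decreasing order. With [B] numbered from 0, the
   [k]-th arc is [[b k, b k.+1]], for [k.+1 < size B]. An endpoint common to two
   arcs is fixed by the reflection of either, so in [rho] any reflected arc
   containing [c] may be used. As in [reg], the subtraction is exact: within an
   arc the path stays at distance less than [e] from the wall. *)
Definition reflected_arc (e p : nat) (Z eta : seq nat) (k : nat) : bool :=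
  let B := walls e eta in
  let b := nth 0 B in
  let w := nth 0 (0 :: rcons [seq last 0 (walls (p ^ z * e) eta) | z <- Z]
                             (last 0 B)) in
  (nth 0 eta (b k) == nth 0 eta (b k.+1)) &&
  has (fun i => [&& odd i, w i <= b k & b k.+1 <= w i.+1]) (iota 1 (size Z)).

Definition rho (e p : nat) (Z eta : seq nat) : seq nat :=
  if p == 0 then eta else
  let B := walls e eta in
  let b := nth 0 B in
  mkseq (fun c =>
    let ks := [seq k <- iota 0 (size B).-1
                 | reflected_arc e p Z eta k && (b k <= c <= b k.+1)] in
    if ks is k :: _ then 2 * nth 0 eta (b k) - nth 0 eta c else nth 0 eta c)
  (size eta).

Definition regT (e p : nat) (t : tableau) : tableau :=
  tab_of (reg_ep e p (path_of t)).

Definition r_tab (e : nat) (t : tableau) : nat := r_path e (path_of t).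

Definition DStd (e p : nat) (mu : seq nat) : seq tableau :=
  [seq t <- Std mu | regT e p t == t].

(* Std_{e,p,mu}(la) *)
Definition Std_reg (e p : nat) (mu la : seq nat) : seq tableau :=
  [seq t <- Std la | regT e p t \in Std mu].

(* reg'_{e,p,la,mu}: the common regularisation set of the elements of
   Std_{e,p,mu}(la) is read off from [t] itself. *)
Definition reg' (e p : nat) (t : tableau) : tableau :=
  tab_of (rho e p (reg_set e p (path_of t)) (path_of (regT e p t))).

(* Main.v *)
Require Import Defs.
From HB Require Import structures.
From mathcomp Require Import all_boot all_order all_algebra.
From mathcomp Require Import zify ring.
Set Implicit Arguments.
Unset Strict Implicit.
Unset Printing Implicit Defensive.
Import Order.TTheory GRing.Theory Num.Theory.
Local Open Scope nat_scope.

(** Everything happens on paths: a two-column tableau is the path of the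
    differences of its column lengths, and its shape is the end of the path.
    A wall of level [z] is a height [m * e * p ^ z - 1] with [m >= 1].

    _Residues and degrees._ Mirroring a step of a path at a wall keeps its
    residue ([path_res_mirror]). The degree of a path counts [+1] for a down
    step that leaves a level 0 wall and [-1] for one that reaches such a wall
    ([std2_deg]). Cut the path at its level 0 walls. A piece that joins two
    different walls has degree 0, whereas a piece that returns to its wall has
    degree [+1] or [-1] according to whether it runs below or above the wall
    ([arc_deg]), and the piece after the last wall contributes 1 exactly if it
    runs below ([path_degE]). So the degree only depends on the side taken by
    the returning pieces and by the last one.

    _The recursion._ Suppose that the recursion takes [pi] to [eta], using the
    levels [Z = {z1 > ... > zh}]. No step of it changes the positions of the
    visits to walls of any level ([walls_reg]): heights that are symmetric about
    a wall of level [z] are on walls of a lower level simultaneously, and after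
    the last visit to level [z] there are no walls of a higher level. Hence the
    mirrorings take place after the last visits [w1 <= ... <= wh] of [eta]
    itself to walls of levels [z1, ..., zh], and the direction of a step is
    reversed once for each [wi] before it ([chain_up]). The map [rho_Z] reflects
    those returning pieces of [eta] that lie after an odd number of the [wi]
    ([reflected_arcE]), which gives back the side that they had in [pi]. The
    last piece of [eta] runs above its wall. So [rho_Z eta] and [pi] have the
    same residues, and their degrees differ by [r_path e pi] ([rho_deg]).

    _Bijectivity._ The map [rho_Z] is an involution on regular paths with a given
    end ([rho_invol], [rho_regular]), and [eta] determines [pi] once [Z] is known
    ([chain_inj]). It remains to see that [Z] depends only on the ends of [pi]
    and [eta], and that conversely any regular path with the end of [eta] comes
    from some path by the levels [Z]. Write [X] for the end of [eta] plus 1. The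
    last wall of level [z] met by a regular path is at the height given by
    rounding [X] down to a multiple of [e * p ^ z] ([regular_floor]), so undoing
    the recursion is arithmetic on the ends ([chain_end]). The sets [Z] that
    occur are given by digits of [X] ([admissible]): sufficient by
    [chain_exists], necessary by [chain_admissible]. Among these sets, the end of
    [pi] determines [Z] ([source_end_inj]).

    _Characteristic 0._ For paths of length [n] and [p > n + 1] there are no
    walls of positive level, so [reg_{e,p}] is [reg_e] and [rho_Z] is the
    identity. Thus the case [p = 0] agrees with that of [p = n + 2], and the
    argument above is carried out for an arbitrary [p > 1]. *)

(** * Paths and their visits to walls *)

Definition is_path (n : nat) (pi : seq nat) : Prop :=
  [/\ size pi = n.+1, nth 0 pi 0 = 0 &
      forall c, c < n -> nth 0 pi c.+1 = (nth 0 pi c).+1 \/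
                         nth 0 pi c = (nth 0 pi c.+1).+1].

Definition mirror_after (a : nat) (pi : seq nat) : seq nat :=
  mkseq (fun b => if b <= a then nth 0 pi b else 2 * nth 0 pi a - nth 0 pi b)
        (size pi).

Definition lastwall (d : nat) (pi : seq nat) : nat := last 0 (walls d pi).

Definition up (pi : seq nat) (c : nat) : bool := nth 0 pi c < nth 0 pi c.+1.

Section Paths.

Variable n : nat.
Implicit Types (pi eta : seq nat) (d a b c u v : nat).

Lemma path_last pi : is_path n pi -> last 0 pi = nth 0 pi n.
Proof. by case=> sz _ _; rewrite (last_nth 0) sz; case: pi sz => //= x s ->. Qed.

Lemma path_ext pi eta : is_path n pi -> size eta = n.+1 ->
  (forall c, c <= n -> nth 0 eta c = nth 0 pi c) -> eta = pi.
Proof.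
case=> sz _ _ sz' H; apply: (@eq_from_nth _ 0); first by rewrite sz sz'.
by rewrite sz' => i; rewrite ltnS => /H.
Qed.

Lemma path_height pi c : is_path n pi -> c <= n -> nth 0 pi c <= c.
Proof.
case=> _ z0 st; elim: c => [|c IH] hc; first by rewrite z0.
by have := IH (ltnW hc); case: (st c hc); lia.
Qed.

Lemma mem_walls d pi b : (b \in walls d pi) = (b < size pi) && (d %| (nth 0 pi b).+1).
Proof. by rewrite mem_filter mem_iota add0n andbC. Qed.

Lemma walls_sorted d pi : sorted ltn (walls d pi).
Proof. exact: (sorted_filter ltn_trans _ (iota_ltn_sorted _ _)). Qed.

Lemma le_lastwall d pi b : b \in walls d pi -> b <= lastwall d pi.
Proof.
rewrite /lastwall => hb.
rewrite -nth_last -{1}(nth_index 0 hb).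
have hi : index b (walls d pi) < size (walls d pi) by rewrite index_mem.
apply: (sorted_leq_nth leq_trans leqnn) => //; try by rewrite inE; lia.
- by apply: sub_sorted (walls_sorted d pi) => x y; apply: ltnW.
- lia.
Qed.

Lemma lastwall_mem d pi : lastwall d pi <> 0 -> lastwall d pi \in walls d pi.
Proof. by rewrite /lastwall; case: (walls d pi) => //= x s _; apply: mem_last. Qed.

Lemma lastwall_le d pi : is_path n pi -> lastwall d pi <= n.
Proof.
case=> sz _ _; case: (lastwall d pi =P 0) => [->//|/lastwall_mem].
by rewrite mem_walls sz => /andP[].
Qed.

Lemma lastwall_dvd d pi : lastwall d pi <> 0 -> d %| (nth 0 pi (lastwall d pi)).+1.
Proof. by move/lastwall_mem; rewrite mem_walls => /andP[]. Qed.

Lemma after_lastwall d pi c : is_path n pi -> lastwall d pi < c <= n ->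
  ~~ (d %| (nth 0 pi c).+1).
Proof.
case=> sz _ _ /andP[h1 h2]; apply/negP => hd.
have : c \in walls d pi by rewrite mem_walls sz ltnS h2.
by move/le_lastwall; lia.
Qed.

Lemma wall_gt0 d pi b : 1 < d -> is_path n pi -> b \in walls d pi -> 0 < b.
Proof.
move=> d1 [_ z0 _]; rewrite mem_walls; case: b => //; rewrite z0.
by rewrite dvdn1 => /andP[_ /eqP]; lia.
Qed.

(** Steps have size 1, so a path can only leave the strip between two adjacent
    walls through one of them. *)
Lemma confine_up d pi u v : is_path n pi -> v <= n.+1 ->
  d %| (nth 0 pi u).+1 -> up pi u ->
  (forall c, u < c < v -> ~~ (d %| (nth 0 pi c).+1)) ->
  forall c, u < c < v -> nth 0 pi u < nth 0 pi c < nth 0 pi u + d.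
Proof.
move=> [_ _ st] hv du upu nw; elim=> [//|c IH] /andP[h1 h2].
have := nw c.+1; rewrite h1 h2 => /(_ isT) nwc.
have hb : nth 0 pi u <= nth 0 pi c.+1 <= nth 0 pi u + d.
  have hd : 0 < d by case: (d) du => //; rewrite dvd0n.
  have [huc|huc|E] := ltngtP u c; last 1 first.
  - by subst c; have := st u; rewrite /up in upu; lia.
  - have /IH : u < c < v by lia.
    have := st c; lia.
  - by lia.
have n1 : nth 0 pi c.+1 <> nth 0 pi u by move=> E; rewrite E du in nwc.
(* the upper wall of the strip is ruled out in the same way as the lower one *)
have n2 : nth 0 pi c.+1 <> nth 0 pi u + d.
  by move=> E; rewrite E -addSn dvdn_addl ?dvdnn ?du in nwc.
lia.
Qed.

Lemma confine_dn d pi u v : is_path n pi -> v <= n.+1 -> u < n ->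
  d %| (nth 0 pi u).+1 -> ~~ up pi u ->
  (forall c, u < c < v -> ~~ (d %| (nth 0 pi c).+1)) ->
  forall c, u < c < v -> nth 0 pi c < nth 0 pi u < nth 0 pi c + d.
Proof.
move=> [_ _ st] hv hu du upu nw; elim=> [//|c IH] /andP[h1 h2].
have := nw c.+1; rewrite h1 h2 => /(_ isT) nwc.
have hb : nth 0 pi c.+1 <= nth 0 pi u <= nth 0 pi c.+1 + d.
  have hd : 0 < d by case: (d) du => //; rewrite dvd0n.
  have [huc|huc|E] := ltngtP u c; last 1 first.
  - by subst c; have := st u; rewrite /up in upu; lia.
  - have /IH : u < c < v by lia.
    have := st c; lia.
  - by lia.
have n1 : nth 0 pi c.+1 <> nth 0 pi u by move=> E; rewrite E du in nwc.
have n2 : nth 0 pi u <> nth 0 pi c.+1 + d.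
  by move=> E; move: du; rewrite E -addSn dvdn_addl ?dvdnn // (negbTE nwc).
lia.
Qed.

(** * One mirroring *)

(** A path starts at height 0, which is not a wall. So if there are no walls,
    then the default value 0 of [lastwall] makes the comparison with the end
    hold. *)
Lemma regE d pi : 1 < d -> is_path n pi ->
  reg d pi = if nth 0 pi (lastwall d pi) <= last 0 pi then pi
             else mirror_after (lastwall d pi) pi.
Proof.
move=> d1 [sz z0 _]; rewrite /reg /mirror_after /lastwall.
by case: (walls d pi) => [|x s] //=; rewrite z0.
Qed.

Lemma nth_mirror_after a pi c : is_path n pi -> c <= n ->
  nth 0 (mirror_after a pi) c = if c <= a then nth 0 pi c else 2 * nth 0 pi a - nth 0 pi c.
Proof. by case=> sz _ _ hc; rewrite nth_mkseq ?sz. Qed.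

Lemma size_mirror_after a pi : size (mirror_after a pi) = size pi.
Proof. exact: size_mkseq. Qed.

(** The bound makes the truncated subtraction exact, so that every step after
    [a] is just reversed. *)
Lemma mirror_after_path a pi : is_path n pi ->
  (forall c, a < c <= n -> nth 0 pi c <= 2 * nth 0 pi a) -> is_path n (mirror_after a pi).
Proof.
move=> P hb; have [sz z0 st] := P; split; first by rewrite size_mirror_after.
  by rewrite nth_mirror_after.
move=> c hc; rewrite !nth_mirror_after //; last exact: ltnW.
have := st c hc; have := hb c; have := hb c.+1.
case: (ltngtP c a) => [||<-]; try lia.
Qed.

(** The mirroring moves the end of the path whenever it applies, so whether a
    path is fixed can be read off from its end. *)
Lemma reg_neq d pi : 1 < d -> is_path n pi ->
  (reg d pi == pi) = (nth 0 pi (lastwall d pi) <= last 0 pi).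
Proof.
move=> d1 P; rewrite regE //; case: ifP => h; first by rewrite eqxx.
apply/eqP => /(congr1 (fun s => nth 0 s n)).
rewrite /= nth_mirror_after //; move: h; rewrite (path_last P) => h.
case: leqP => [hn|hn]; last by lia.
have E : lastwall d pi = n by have := lastwall_le d P; lia.
by rewrite E leqnn in h.
Qed.

(** If [reg d] moves the path, then its tail is confined to the strip just
    below the last wall. *)
Lemma below_down d pi : 1 < d -> is_path n pi -> reg d pi <> pi ->
  [/\ 0 < lastwall d pi < n, d %| (nth 0 pi (lastwall d pi)).+1 &
   forall c, lastwall d pi < c <= n ->
     nth 0 pi c < nth 0 pi (lastwall d pi) < nth 0 pi c + d].
Proof.
move=> d1 P /eqP; rewrite reg_neq // (path_last P) -ltnNge => h.
have [sz z0 st] := P.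
have w0 : 0 < lastwall d pi by rewrite lt0n; apply/eqP => E; rewrite E z0 in h.
have wn : lastwall d pi < n.
  rewrite ltn_neqAle lastwall_le // andbT.
  by apply/eqP => E; rewrite E ltnn in h.
have dw := @lastwall_dvd d pi ltac:(lia).
have nw c : lastwall d pi < c < n.+1 -> ~~ (d %| (nth 0 pi c).+1).
  by move=> hc; apply: after_lastwall.
split=> //; first by rewrite w0.
case hu: (up pi (lastwall d pi)).
  have := confine_up P (leqnn _) dw hu nw (c := n); lia.
by move=> c hc; apply: (confine_dn P (leqnn _) wn dw (negbT hu) nw).
Qed.

(** If [reg d] fixes the path, then its tail is confined to the strip just
    above the last wall. *)
Lemma above_up d pi : 1 < d -> is_path n pi -> reg d pi = pi ->
   forall c, 0 < lastwall d pi < c -> c <= n ->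
     nth 0 pi (lastwall d pi) < nth 0 pi c < nth 0 pi (lastwall d pi) + d.
Proof.
move=> d1 P /eqP; rewrite reg_neq // (path_last P) => h c /andP[w0 wc] cn.
have wn : lastwall d pi < n by lia.
have dw := @lastwall_dvd d pi ltac:(lia).
have nw c' : lastwall d pi < c' < n.+1 -> ~~ (d %| (nth 0 pi c').+1).
  by move=> hc; apply: after_lastwall.
case hu: (up pi (lastwall d pi)).
  by apply: (confine_up P (leqnn _) dw hu nw); lia.
have := confine_dn P (leqnn _) wn dw (negbT hu) nw (c := n); lia.
Qed.

Lemma reg_path d pi : 1 < d -> is_path n pi -> is_path n (reg d pi).
Proof.
move=> d1 P; have [->|ne] := (reg d pi =P pi)=> //.
have [_ _ B] := below_down d1 P ne.
move: ne => /eqP; rewrite reg_neq // regE // => /negbTE ->.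
by apply: mirror_after_path => // c hc; have := B c hc; lia.
Qed.

Lemma nth_reg d pi c : 1 < d -> is_path n pi -> reg d pi <> pi -> c <= n ->
  nth 0 (reg d pi) c = if c <= lastwall d pi then nth 0 pi c
      else 2 * nth 0 pi (lastwall d pi) - nth 0 pi c.
Proof.
move=> d1 P /eqP; rewrite reg_neq // regE // => /negbTE -> hc.
by rewrite nth_mirror_after.
Qed.

Lemma walls_ext d pi eta : size pi = size eta ->
  (forall c, c < size pi -> (d %| (nth 0 pi c).+1) = (d %| (nth 0 eta c).+1)) ->
  walls d pi = walls d eta.
Proof.
move=> sz H; rewrite /walls -sz; apply: eq_in_filter => c.
by rewrite mem_iota /= => /H.
Qed.

(** The heights [x] and [y] are symmetric about the wall [w]; recall that walls
    are the heights one less than a multiple of [d]. *)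
Lemma dvdn_reflect d x y w : d %| w.+1 -> x.+1 + y.+1 = w.+1 + w.+1 ->
  (d %| x.+1) = (d %| y.+1).
Proof.
move=> dw E; apply/idP/idP => h.
  by rewrite -(dvdn_addr _ h) E dvdn_add.
by rewrite -(dvdn_addl _ h) E dvdn_add.
Qed.

(** If [d] divides [d'], then the mirror is a wall for [d] as well, and
    symmetric heights are on walls simultaneously. If [d'] divides [d], then
    the mirrored tail lies strictly between two adjacent walls for [d'], before
    and after, so it meets no wall for [d] at all. *)
Lemma walls_reg d d' pi : 1 < d -> 1 < d' -> (d %| d') || (d' %| d) ->
  is_path n pi -> walls d (reg d' pi) = walls d pi.
Proof.
move=> d1 d1' hd P; have [->|ne] := (reg d' pi =P pi)=> //.
have [/andP[w0 wn] dw B] := below_down d1' P ne.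
have Pr := reg_path d1' P.
have [sz _ _] := P; have [szr _ _] := Pr.
apply: walls_ext; first by rewrite sz szr.
rewrite szr => c; rewrite ltnS => hc; rewrite nth_reg //.
case: leqP => // wc.
have Bc := B c; rewrite wc hc in Bc; have {}Bc := Bc isT.
(* the mirrored height is symmetric to the old one, since the tail is below the mirror *)
have E : (2 * nth 0 pi (lastwall d' pi) - nth 0 pi c).+1 + (nth 0 pi c).+1
    = (nth 0 pi (lastwall d' pi)).+1 + (nth 0 pi (lastwall d' pi)).+1 by lia.
case/orP: hd => hd.
  by apply: dvdn_reflect E; apply: dvdn_trans dw.
have nc : ~~ (d' %| (nth 0 pi c).+1) by apply: after_lastwall => //; rewrite wc.
have := dvdn_reflect dw E; rewrite (negbTE nc) => nc'.
by apply/idP/idP => /(dvdn_trans hd); rewrite ?nc' ?(negbTE nc).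
Qed.

Lemma lastwall_reg d d' pi : 1 < d -> 1 < d' -> (d %| d') || (d' %| d) ->
  is_path n pi -> lastwall d (reg d' pi) = lastwall d pi.
Proof. by move=> d1 d1' hd P; rewrite /lastwall walls_reg. Qed.

(** The mirroring does not move the last visit to a wall, hence it can be
    undone knowing only its result. *)
Lemma mirror_after_reg d pi : 1 < d -> is_path n pi -> reg d pi <> pi ->
  mirror_after (lastwall d pi) (reg d pi) = pi.
Proof.
move=> d1 P ne; have Pr := reg_path d1 P; have [szr _ _] := Pr.
have [_ _ B] := below_down d1 P ne.
apply: (path_ext P); first by rewrite size_mirror_after.
move=> c hc; rewrite nth_mirror_after // !nth_reg // ?leqnn; last exact: lastwall_le.
by case: leqP => // wc; have := B c; lia.
Qed.

Lemma reg_idem d pi : 1 < d -> is_path n pi -> reg d (reg d pi) = reg d pi.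
Proof.
move=> d1 P; have [E|ne] := (reg d pi =P pi); first by rewrite !E.
have Pr := reg_path d1 P; have [/andP[w0 wn] _ B] := below_down d1 P ne.
apply/eqP; rewrite reg_neq // lastwall_reg ?dvdnn // (path_last Pr) !nth_reg //.
  by rewrite leqnn (leqNgt n) wn /=; have := B n; lia.
exact: ltnW.
Qed.

Lemma up_mirror_after a pi c : is_path n pi -> c < n ->
  (forall c, a < c <= n -> nth 0 pi c <= 2 * nth 0 pi a) ->
  up (mirror_after a pi) c = up pi c (+) (a <= c).
Proof.
move=> P hc hb; have [_ _ st] := P; rewrite /up !nth_mirror_after //; last exact: ltnW.
have := st c hc; have := hb c; have := hb c.+1.
by case: (ltngtP c a) => [||<-] /=; rewrite ?addbF ?addbT -?leqNgt; lia.
Qed.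

End Paths.

(** * Numbering the walls met by a path *)

(** In a sorted list the entries up to [c] form an initial segment, which the
    count of such entries describes. *)
Lemma sorted_nth_count (s : seq nat) c j : sorted leq s -> j < size s ->
  (nth 0 s j <= c) = (j < count (fun x => x <= c) s).
Proof.
elim: s j => [|x s IH] j //= srt hj.
have pa := srt; rewrite (path_sortedE leq_trans) in pa; case/andP: pa => mn ss.
have [xc|cx] := leqP x c; last first.
  have -> : count (fun y => y <= c) s = 0.
    apply/eqP; rewrite -leqn0 leqNgt -has_count -all_predC.
    apply/allP => y /(allP mn) lxy; rewrite /= -ltnNge; exact: leq_trans cx lxy.
  case: j hj => [|j] /= hj; first lia.
  have lxy : x <= nth 0 s j := allP mn _ (mem_nth 0 hj).
  by apply/negbTE; lia.
by case: j hj => [|j] /= hj; [rewrite xc | rewrite IH // add1n ltnS].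
Qed.

Section Walls.

Variables (e n : nat) (eta : seq nat).
Local Notation B := (walls e eta).
Local Notation b := (nth 0 (walls e eta)).

Lemma wall_dvd k : k < size B -> e %| (nth 0 eta (b k)).+1.
Proof. by move/(mem_nth 0); rewrite mem_walls => /andP[]. Qed.

Lemma wall_lt k k' : k' < size B -> k < k' -> b k < b k'.
Proof.
by move=> h h'; apply: (sorted_ltn_nth ltn_trans 0 (walls_sorted e eta)); rewrite ?inE //; lia.
Qed.

Lemma wall_leq k k' : k' < size B -> k <= k' -> b k <= b k'.
Proof.
by move=> h; rewrite leq_eqVlt => /predU1P[->//|/(wall_lt h)/ltnW].
Qed.

Lemma last_wall_nth : 0 < size B -> lastwall e eta = b (size B).-1.
Proof. by rewrite /lastwall nth_last. Qed.

Lemma wall_le_last k : k < size B -> b k <= lastwall e eta.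
Proof. by move=> h; apply: le_lastwall; apply: mem_nth. Qed.

Variant arc_spec c : Prop :=
| ArcIn k of k.+1 < size B & b k <= c < b k.+1
| ArcBefore of (forall k, k < size B -> c < b k)
| ArcAfter of 0 < size B & lastwall e eta <= c.

Lemma arcP c : arc_spec c.
Proof.
have srt : sorted leq B.
  by apply: sub_sorted (walls_sorted e eta) => x y; apply: ltnW.
have nc j := @sorted_nth_count B c j srt.
have ms := count_size (fun x => x <= c) B.
set m := count _ _ in nc ms.
case: m nc ms => [|k] nc ms.
  by apply: ArcBefore => k hk; have := nc k hk; lia.
have hk := nc k ltac:(lia).
have [lt|ge] := ltnP k.+1 (size B).
  by apply: (@ArcIn _ k) => //; have := nc k.+1 lt; lia.
apply: ArcAfter; first by lia.
rewrite last_wall_nth; last by lia.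
(* the count is the size, so that [c] is after all walls *)
have E : (size B).-1 = k by lia.
by rewrite E hk ltnSn.
Qed.

Hypothesis P : is_path n eta.

Lemma wall_le_n k : k < size B -> b k <= n.
Proof.
by move/(mem_nth 0); rewrite mem_walls; case: P => -> _ _; rewrite ltnS => /andP[].
Qed.

Lemma wall_pos k : 1 < e -> k < size B -> 0 < b k.
Proof. by move=> e1 /(mem_nth 0); apply: wall_gt0 e1 P. Qed.

Lemma wall_between k c : k.+1 < size B -> b k < c < b k.+1 ->
  ~~ (e %| (nth 0 eta c).+1).
Proof.
move=> hk /andP[h1 h2]; apply/negP => hd.
have cB : c \in B.
  rewrite mem_walls hd andbT; case: P => -> _ _; have := wall_le_n hk; lia.
have hi : index c B < size B by rewrite index_mem.
have E : b (index c B) = c := nth_index 0 cB; rewrite -E in h1 h2.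
have [hle|hgt] := leqP (index c B) k.
  have := @wall_leq (index c B) k ltac:(lia) hle; lia.
have := @wall_leq k.+1 (index c B) hi hgt; lia.
Qed.

(** A piece returning to its wall stays at distance less than [e] from it, and
    the wall has height at least [e - 1]. So reflecting the piece at this wall
    produces no negative heights. *)
Lemma arc_bounds k c : k.+1 < size B -> nth 0 eta (b k) = nth 0 eta (b k.+1) ->
  b k <= c <= b k.+1 -> nth 0 eta c <= 2 * nth 0 eta (b k).
Proof.
move=> hk E hc.
have hk' : k < size B by lia.
have du := wall_dvd hk'.
have eb : e <= (nth 0 eta (b k)).+1 by apply: dvdn_leq.
have lt := wall_lt hk (ltnSn k).
have ln := wall_le_n hk.
have nw c' : b k < c' < b k.+1 -> ~~ (e %| (nth 0 eta c').+1) by apply: wall_between.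
have [E1|[E2|hin]] : c = b k \/ c = b k.+1 \/ b k < c < b k.+1 by lia.
- rewrite E1; lia.
- rewrite E2 -E; lia.
case hu: (up eta (b k)).
  have := confine_up P (leqW ln) du hu nw hin; lia.
have kn : b k < n by lia.
have := confine_dn P (leqW ln) kn du (negbT hu) nw hin; lia.
Qed.

End Walls.

(** * The regularisation recursion *)

Section Chain.

Variables (e p n : nat).
Hypotheses (e1 : 1 < e) (p1 : 1 < p).
Implicit Types (pi eta : seq nat) (Z : seq nat).

(** The distance between adjacent walls of level [z]. *)
Definition gap (z : nat) : nat := e * p ^ z.

Lemma gap_gt1 z : 1 < gap z.
Proof.
have h : 0 < p ^ z by rewrite expn_gt0; lia.
by rewrite /gap; apply: leq_trans e1 _; rewrite leq_pmulr.
Qed.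

Lemma gap_dvd z z' : z <= z' -> gap z %| gap z'.
Proof. by move=> h; rewrite /gap dvdn_pmul2l ?dvdn_exp2l //; lia. Qed.

Lemma gap_cmp z z' : (gap z %| gap z') || (gap z' %| gap z).
Proof. by case: (leqP z z') => [|/ltnW] /gap_dvd ->; rewrite ?orbT. Qed.

Lemma gap_large z : z < gap z.
Proof.
rewrite /gap; have := ltn_expl z p1; have := leq_pmull (p ^ z) (ltnW e1); lia.
Qed.

Definition regular pi : Prop := forall z, reg (gap z) pi = pi.

(** [regchain Z pi eta] says that the recursion started at [pi] ends at [eta]
    and uses the levels [Z] in this order. Being free of fuel, it supports
    induction on the mirrorings made. *)
Inductive regchain : seq nat -> seq nat -> seq nat -> Prop :=
| Chain_nil pi : regular pi -> regchain [::] pi pi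
| Chain_cons z Z pi eta : reg (gap z) pi <> pi ->
    (forall z', z < z' -> reg (gap z') pi = pi) ->
    regchain Z (reg (gap z) pi) eta -> regchain (z :: Z) pi eta.

Lemma lastwall_mono z z' pi : z <= z' -> lastwall (gap z') pi <= lastwall (gap z) pi.
Proof.
move=> h; have [->//|/eqP/lastwall_mem] := eqVneq (lastwall (gap z') pi) 0.
rewrite mem_walls => /andP[h1 h2]; apply: le_lastwall.
by rewrite mem_walls h1 (dvdn_trans (gap_dvd h)).
Qed.

Lemma lastwall_reg_gap z z' pi : is_path n pi ->
  lastwall (gap z) (reg (gap z') pi) = lastwall (gap z) pi.
Proof. by apply: lastwall_reg; rewrite ?gap_gt1 ?gap_cmp. Qed.

(** The higher levels stay settled after a mirroring: the end moves up, while
    the last walls of higher levels were visited before the mirror and keep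
    their heights. So the levels used by the recursion decrease. *)
Lemma reg_step_fixed z pi : is_path n pi -> reg (gap z) pi <> pi ->
  (forall z', z < z' -> reg (gap z') pi = pi) ->
  forall z', z <= z' -> reg (gap z') (reg (gap z) pi) = reg (gap z) pi.
Proof.
move=> P ne fx z'; rewrite leq_eqVlt => /predU1P[<-|lt].
  by apply: reg_idem (gap_gt1 z) P.
have Pr := reg_path (gap_gt1 z) P.
have [/andP[w0 wn] _ B] := below_down (gap_gt1 z) P ne.
have := fx _ lt => /eqP; rewrite (@reg_neq n) ?gap_gt1 // => h.
apply/eqP; rewrite (@reg_neq n) ?gap_gt1 // lastwall_reg_gap // (path_last Pr).
rewrite !(@nth_reg n) ?gap_gt1 ?(@lastwall_le n) // lastwall_mono ?(ltnW lt) // (leqNgt n) wn /=.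
have := B n; rewrite wn leqnn; move: h; rewrite (path_last P); lia.
Qed.

Lemma chain_inv Z pi eta : regchain Z pi eta -> is_path n pi ->
  [/\ is_path n eta, regular eta & forall z, walls (gap z) eta = walls (gap z) pi].
Proof.
elim=> {Z pi eta} [//|z Z pi eta ne fx _ IH P].
have [Pe re we] := IH (reg_path (gap_gt1 z) P); split=> // z'.
by rewrite we; apply: walls_reg P; rewrite ?gap_gt1 ?gap_cmp.
Qed.

Lemma chain_lastwall Z pi eta z : regchain Z pi eta -> is_path n pi ->
  lastwall (gap z) eta = lastwall (gap z) pi.
Proof. by move=> ch /(chain_inv ch)[_ _ E]; rewrite /lastwall E. Qed.

Lemma chain_lt Z pi eta k : regchain Z pi eta -> is_path n pi ->
  (forall z, k <= z -> reg (gap z) pi = pi) -> all (fun z => z < k) Z.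
Proof.
move=> ch; elim: ch k => {Z pi eta} [//|z Z pi eta ne fx _ IH k P fk] /=.
have zk : z < k by rewrite ltnNge; apply/negP => /fk.
rewrite zk; apply: sub_all (IH z _ _) => [x /ltn_trans -> //||].
  exact: reg_path (gap_gt1 z) P.
exact: reg_step_fixed.
Qed.

Lemma chain_sorted Z pi eta : regchain Z pi eta -> is_path n pi -> sorted gtn Z.
Proof.
elim=> {Z pi eta} [//|z Z pi eta ne fx ch IH P] /=.
have Pr := reg_path (gap_gt1 z) P.
rewrite (path_sortedE (rev_trans ltn_trans)) IH // andbT.
exact: chain_lt ch Pr (reg_step_fixed P ne fx).
Qed.

(** All mirrorings affect only what comes after the last visits to the walls of
    the levels in [Z]. *)
Lemma chain_agree Z pi eta c : regchain Z pi eta -> is_path n pi -> c <= n ->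
  {in Z, forall z, c <= lastwall (gap z) eta} -> nth 0 eta c = nth 0 pi c.
Proof.
elim=> {Z pi eta} [//|z Z pi eta ne fx ch IH P cn H].
have Pr := reg_path (gap_gt1 z) P.
rewrite IH // => [|z' hz']; last by apply: H; rewrite inE hz' orbT.
rewrite (@nth_reg n) ?gap_gt1 //.
have := H z (mem_head _ _).
by rewrite (chain_lastwall _ ch Pr) lastwall_reg_gap // => ->.
Qed.

(** A regular path ends in the strip above its last wall of level [z], so this
    wall is found by rounding the end down. *)
Lemma regular_floor pi z : is_path n pi -> regular pi -> 0 < lastwall (gap z) pi ->
  (last 0 pi).+1 %/ gap z * gap z = (nth 0 pi (lastwall (gap z) pi)).+1.
Proof.
move=> P R w0; rewrite (path_last P).
have dw := @lastwall_dvd (gap z) pi ltac:(lia).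
have [E|lt] : lastwall (gap z) pi = n \/ lastwall (gap z) pi < n.
  by have := lastwall_le (gap z) P; lia.
  by move: dw; rewrite E => /divnK.
have B := above_up (gap_gt1 z) P (R z) (c := n).
rewrite w0 lt leqnn in B; have {}B := B isT isT.
case/dvdnP: dw => k Ek; rewrite Ek; congr (_ * _).
set x := nth 0 pi n in B *.
have -> : x.+1 = k * gap z + (x.+1 - k * gap z) by lia.
rewrite divnMDl ?divn_small ?addn0 //; lia.
Qed.

(** A path ending at or above the lowest wall of level [z] must cross it. *)
Lemma regular_wall pi z : is_path n pi -> gap z <= (last 0 pi).+1 ->
  0 < lastwall (gap z) pi.
Proof.
move=> P; rewrite (path_last P) => h; rewrite lt0n; apply/eqP => E.
have [sz z0 st] := P.
suff : forall c, c <= n -> (nth 0 pi c).+1 < gap z by move/(_ n (leqnn n)); lia.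
elim=> [_|c IH cn]; first by rewrite z0 gap_gt1.
have := @after_lastwall n (gap z) pi c.+1 P; rewrite E cn => /(_ isT) nd.
have ne : (nth 0 pi c.+1).+1 <> gap z by move=> F; rewrite F dvdnn in nd.
have := IH (ltnW cn); have := st c cn; lia.
Qed.

(** Expand [X] by its remainder modulo [e] and its quotient by [e] in base [p].
    The condition says that [Z] is decreasing, that the digit of [X] at each
    level in [Z] is nonzero, and that some digit below the last level in [Z] is
    nonzero. *)
Fixpoint admissible (X : nat) Z : bool :=
  if Z is z :: Z' then
    [&& all (fun z' => z' < z) Z', ~~ (p %| X %/ gap z) &
        if Z' is [::] then ~~ (gap z %| X) else admissible X Z']
  else true.

(** If [X - 1] is the end of a path that comes from the mirrorings of levels
    [Z], then undoing these in turn gives the path with end [source_end X Z -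
    1], since the mirrors are at the walls found by rounding [X] down. *)
Fixpoint source_end (X : nat) Z : nat :=
  if Z is z :: Z' then 2 * (X %/ gap z * gap z) - source_end X Z' else X.

(** If the digit at the level [z] used by the recursion were zero, then the
    mirror would be a wall of level [z + 1] too, and the path would still end
    below it, contradicting the maximality of [z]. The path passes the last
    mirror and never comes back to a wall of its level, which gives the last
    condition. *)
Lemma chain_admissible Z pi eta : regchain Z pi eta -> is_path n pi ->
  admissible (last 0 eta).+1 Z.
Proof.
elim=> {Z pi eta} [//|z Z pi eta ne fx ch IH P] /=.
have Pr := reg_path (gap_gt1 z) P.
have [Pe Re We] := chain_inv ch Pr.
have ltZ := chain_lt ch Pr (reg_step_fixed P ne fx).
have lw z' : lastwall (gap z') eta = lastwall (gap z') pi.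
  by rewrite (chain_lastwall _ ch Pr) lastwall_reg_gap.
have [/andP[w0 wn] dw B] := below_down (gap_gt1 z) P ne.
apply/and3P; split=> //.
- apply/negP => hp.
  have F := @regular_floor eta z Pe Re; rewrite lw w0 in F; have {}F := F isT.
  have A : nth 0 eta (lastwall (gap z) pi) = nth 0 pi (lastwall (gap z) pi).
    have W := ltnW wn; rewrite (chain_agree ch Pr W).
      by rewrite (nth_reg (gap_gt1 z) P ne W) leqnn.
    by move=> z' /(allP ltZ) /ltnW hz; rewrite lw lastwall_mono.
  have h : gap z.+1 %| (nth 0 pi (lastwall (gap z) pi)).+1.
    rewrite -A -F; case/dvdnP: hp => k ->.
    by rewrite /gap expnS; apply/dvdnP; exists k; lia.
  have : lastwall (gap z) pi \in walls (gap z.+1) pi.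
    by rewrite mem_walls h andbT; case: P => -> _ _; rewrite ltnS ltnW.
  move/le_lastwall => le1.
  have E : lastwall (gap z.+1) pi = lastwall (gap z) pi.
    by apply/eqP; rewrite eqn_leq le1 lastwall_mono.
  have /eqP := fx z.+1 (leqnn _); rewrite (@reg_neq n) ?gap_gt1 // E.
  by have /eqP := ne; rewrite (@reg_neq n) ?gap_gt1 // => /negbTE ->.
- have {}IH := IH Pr.
  case: Z ch IH ltZ => [|z' Z'] ch IH ltZ //.
  rewrite (path_last Pe); apply: (after_lastwall Pe).
  by rewrite lw wn leqnn.
Qed.

Lemma chain_end Z pi eta : regchain Z pi eta -> is_path n pi ->
  (last 0 pi).+1 = source_end (last 0 eta).+1 Z.
Proof.
elim=> {Z pi eta} [//|z Z pi eta ne fx ch IH P] /=.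
have Pr := reg_path (gap_gt1 z) P.
have [Pe Re We] := chain_inv ch Pr.
have ltZ := chain_lt ch Pr (reg_step_fixed P ne fx).
have lw z' : lastwall (gap z') eta = lastwall (gap z') pi.
  by rewrite (chain_lastwall _ ch Pr) lastwall_reg_gap.
have [/andP[w0 wn] dw B] := below_down (gap_gt1 z) P ne.
rewrite regular_floor // lw //.
have -> : nth 0 eta (lastwall (gap z) pi) = nth 0 pi (lastwall (gap z) pi).
  have W := ltnW wn; rewrite (chain_agree ch Pr W).
    by rewrite (nth_reg (gap_gt1 z) P ne W) leqnn.
  by move=> z' /(allP ltZ) /ltnW hz; rewrite lw lastwall_mono.
rewrite -IH // (path_last Pr) (@nth_reg n) ?gap_gt1 // (leqNgt n) wn /= (path_last P).
have := B n; rewrite wn leqnn; lia.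
Qed.

(** A nonzero digit at level [z'] makes rounding down at this level strictly
    better than at any higher level, by at least one gap. *)
Lemma floor_lt X z z' : z' < z -> ~~ (p %| X %/ gap z') ->
  X %/ gap z * gap z + gap z' <= X %/ gap z' * gap z'.
Proof.
move=> lt np.
have Dz : gap z = p ^ (z - z') * gap z'.
  by rewrite /gap mulnCA -expnD subnK // ltnW.
have w0 := gap_gt1 z'.
(* [k] is a multiple of [p], so it cannot be the quotient of [X] by [gap z'] *)
set k := X %/ gap z * p ^ (z - z').
have Ek : X %/ gap z * gap z = k * gap z' by rewrite {2}Dz mulnA.
have pk : p %| k by apply: dvdn_mull; apply: dvdn_exp; rewrite ?subn_gt0.
have : k <= X %/ gap z' by rewrite leq_divRL ?(ltnW w0) // -Ek leq_trunc_div.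
rewrite leq_eqVlt => /predU1P[E|lk]; first by rewrite -E pk in np.
by rewrite Ek -mulSnr leq_mul2r lk orbT.
Qed.

(** By induction, the end before the mirroring at level [z] is in the strip
    below the mirror, and the end after it is in the strip above. Here the next
    mirror is strictly higher by [floor_lt]. *)
Lemma source_end_bounds X z Z : admissible X (z :: Z) ->
  [/\ gap z <= X %/ gap z * gap z,
      X %/ gap z * gap z < source_end X Z < X %/ gap z * gap z + gap z &
      X %/ gap z * gap z - gap z < source_end X (z :: Z) < X %/ gap z * gap z].
Proof.
elim: Z z => [|z' Z IH] z /and3P[lt np ad].
  have w0 := gap_gt1 z.
  have q0 : 0 < X %/ gap z by case: (X %/ gap z) np => //; rewrite dvdn0.
  have h1 : gap z <= X %/ gap z * gap z by rewrite leq_pmull.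
  have h2 : X %/ gap z * gap z < X.
    rewrite ltn_neqAle leq_trunc_div andbT; apply: contra ad => /eqP <-.
    exact: dvdn_mull.
  have h3 : X < X %/ gap z * gap z + gap z.
    by rewrite -mulSnr; apply: ltn_ceil; lia.
  by rewrite /= h1 h2 h3; split=> //; lia.
have w0 := gap_gt1 z.
have q0 : 0 < X %/ gap z by case: (X %/ gap z) np => //; rewrite dvdn0.
have h1 : gap z <= X %/ gap z * gap z by rewrite leq_pmull.
have h3 : X < X %/ gap z * gap z + gap z.
  by rewrite -mulSnr; apply: ltn_ceil; lia.
have [a1 a2 a3] := IH z' ad.
case/andP: lt => lt _; case/and3P: (ad) => _ np' _.
have g := floor_lt lt np'; have := leq_trunc_div X (gap z').
have -> : source_end X [:: z, z' & Z] =
  2 * (X %/ gap z * gap z) - source_end X (z' :: Z) by [].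
by split=> //; move: a3; set s := source_end X (z' :: Z); lia.
Qed.

Lemma source_end_lt X z Z : admissible X (z :: Z) -> source_end X (z :: Z) < X.
Proof.
move=> /source_end_bounds[_ _ h]; have := leq_trunc_div X (gap z); lia.
Qed.

Lemma admissible_tail X z Z : admissible X (z :: Z) -> admissible X Z.
Proof. by case: Z => // z' Z /and3P[]. Qed.

(** The strips below the mirrors of two different levels are disjoint by
    [floor_lt], so [source_end] determines the largest level; then remove this
    level and repeat. *)
Lemma source_end_inj X Z Z' : admissible X Z -> admissible X Z' ->
  source_end X Z = source_end X Z' -> Z = Z'.
Proof.
elim: Z Z' => [|z Z IH] [|z' Z'] // ad ad'.
- by move=> E; have := source_end_lt ad'; rewrite -E ltnn.
- by move=> E; have := source_end_lt ad; rewrite E ltnn.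
move=> E.
have [b1 b2 b3] := source_end_bounds ad; have [b1' b2' b3'] := source_end_bounds ad'.
have Ez : z = z'.
  have := ad => /and3P[_ np _]; have := ad' => /and3P[_ np' _].
  have [lt|lt|//] := ltngtP z z'.
    have := floor_lt lt np; lia.
  have := floor_lt lt np'; lia.
subst z'; congr (_ :: _); apply: IH; try exact: admissible_tail ad;
  try exact: admissible_tail ad'.
have : 2 * (X %/ gap z * gap z) - source_end X Z =
       2 * (X %/ gap z * gap z) - source_end X Z' by [].
lia.
Qed.

(** The level to use is determined as the largest one that moves the path. *)
Lemma chain_fun Z Z' pi eta eta' : regchain Z pi eta -> regchain Z' pi eta' ->
  Z = Z' /\ eta = eta'.
Proof.
move=> ch; elim: ch Z' eta' => {Z pi eta} [pi R|z Z pi eta ne fx ch IH] Z' eta' ch'.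
  by case: ch' R => // z Z'' pi0 eta0 ne _ _ /(_ z).
case: ch' ne fx ch IH => [pi0 R ne|z' Z'' pi0 eta0 ne' fx' ch' ne fx ch IH].
  by have := R z.
have E : z = z'.
  by have [/fx|/fx'|] := ltngtP z z'.
by subst z'; have [-> ->] := IH _ _ ch'.
Qed.

Lemma chain_inj Z pi pi' eta : is_path n pi -> is_path n pi' ->
  regchain Z pi eta -> regchain Z pi' eta -> pi = pi'.
Proof.
move=> P P' ch; elim: ch pi' P P' => {Z pi eta} [pi R|z Z pi eta ne fx ch IH] pi' P P' ch'.
  by inversion ch'.
inversion ch' as [|z' Z' pi'' eta'' ne' fx' ch'']; subst.
have E : reg (gap z) pi = reg (gap z) pi'.
  by apply: IH => //; apply: reg_path => //; apply: gap_gt1.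
rewrite -(mirror_after_reg (gap_gt1 z) P ne) -(mirror_after_reg (gap_gt1 z) P' ne').
by rewrite -(lastwall_reg_gap z z P) -(lastwall_reg_gap z z P') E.
Qed.

Lemma regular_path0 pi z : is_path n pi -> lastwall (gap z) pi = 0 ->
  reg (gap z) pi = pi.
Proof.
by move=> P E; apply/eqP; rewrite (@reg_neq n) ?gap_gt1 // E; case: P => _ -> _.
Qed.

(** Undo the mirrorings from the lowest level upwards. When the level [z] is
    undone at the last visit [w] to its walls, the bounds on [source_end] show
    that the tail is above the mirror and gets below it. Admissibility ensures
    that the walls of higher levels stay at or below the new end, so that the
    recursion does choose [z] next. *)
Lemma chain_exists Z eta : is_path n eta -> regular eta ->
  admissible (last 0 eta).+1 Z -> exists2 pi, is_path n pi & regchain Z pi eta.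
Proof.
move=> Pe Re; set X := (last 0 eta).+1.
elim: Z => [|z Z IH] ad; first by exists eta => //; constructor.
have [pi' P' ch] := IH (admissible_tail ad).
have [b1 b2 b3] := source_end_bounds ad.
have w0 : 0 < lastwall (gap z) eta.
  by apply: regular_wall => //; have := leq_trunc_div X (gap z); lia.
have F := regular_floor Pe Re w0; rewrite -/X in F.
have lw z' := chain_lastwall z' ch P'.
have /and3P[ltZ np _] := ad.
have le_n := lastwall_le (gap z) Pe.
have A c : c <= lastwall (gap z) eta -> nth 0 eta c = nth 0 pi' c.
  move=> hc; apply: (chain_agree ch P'); first by lia.
  move=> z' /(allP ltZ) /ltnW hz; apply: leq_trans hc _; exact: lastwall_mono.
set w := lastwall (gap z) eta in w0 F le_n A *.
have Aw := A w (leqnn w).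
have Ce := chain_end ch P'; rewrite -/X in Ce.
have R' : reg (gap z) pi' = pi'.
  by apply/eqP; rewrite (@reg_neq n) ?gap_gt1 // -lw -/w -Aw; lia.
have B := above_up (gap_gt1 z) P' R'; rewrite -lw -/w -Aw w0 in B.
have wn : w < n.
  rewrite ltn_neqAle le_n andbT; apply/eqP => E.
  have := path_last P'; rewrite -E -Aw; lia.
have P : is_path n (mirror_after w pi').
  by apply: mirror_after_path => // c /andP[h1 h2]; rewrite -Aw; have := B c h1 h2; lia.
have N c : c <= n -> nth 0 (mirror_after w pi') c =
    if c <= w then nth 0 eta c else 2 * nth 0 eta w - nth 0 pi' c.
  by move=> hc; rewrite (@nth_mirror_after n) // -Aw; case: leqP => // /A ->.
have [sz _ _] := P; have [sz' _ _] := P'; have [sze _ _] := Pe.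
have dw : gap z %| (nth 0 eta w).+1 by apply: lastwall_dvd; rewrite -/w; lia.
have LW : lastwall (gap z) (mirror_after w pi') = w.
  rewrite {2}/w lw /lastwall; congr last; apply: walls_ext; first by rewrite sz sz'.
  rewrite sz => c; rewrite ltnS => hc; rewrite N //; case: leqP => h; first by rewrite A.
  by apply: (dvdn_reflect dw); have := B c h hc; lia.
have LE : (last 0 (mirror_after w pi')).+1 = source_end X (z :: Z).
  rewrite (path_last P) N // (leqNgt n) wn /= -Ce F (path_last P').
  have := B n wn (leqnn n); lia.
have NE : reg (gap z) (mirror_after w pi') <> mirror_after w pi'.
  by apply/eqP; rewrite (@reg_neq n) ?gap_gt1 // LW N // leqnn; lia.
have RE : reg (gap z) (mirror_after w pi') = pi'.
  apply: (path_ext P').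
    by case: (reg_path (gap_gt1 z) P).
  move=> c hc; rewrite (@nth_reg n) ?gap_gt1 // LW !N // leqnn.
  by case: leqP => h; [rewrite A | have := B c h hc; lia].
exists (mirror_after w pi') => //; constructor=> //; last by rewrite RE.
move=> z' lt.
have LW' : lastwall (gap z') (mirror_after w pi') = lastwall (gap z') eta.
  by rewrite lw -(lastwall_reg_gap z' z P) RE.
have [E|ne0] := eqVneq (lastwall (gap z') (mirror_after w pi')) 0.
  exact: regular_path0.
apply/eqP; rewrite (@reg_neq n) ?gap_gt1 // LW'.
have le' : lastwall (gap z') eta <= w by apply: lastwall_mono; apply: ltnW.
rewrite N ?le'; last by lia.
have := @regular_floor eta z' Pe Re; rewrite -LW' lt0n ne0 => /(_ isT).
rewrite -/X LW'; have := floor_lt lt np; lia.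
Qed.

(** A mirror of level [z] must be reached within [n] steps. *)
Lemma reg_small z pi : is_path n pi -> reg (gap z) pi <> pi -> z <= n.
Proof.
move=> P ne; have [/andP[w0 wn] dw _] := below_down (gap_gt1 z) P ne.
have := dvdn_leq (ltn0Sn _) dw; have := gap_large z.
have := path_height P (ltnW wn); lia.
Qed.

(** The levels used decrease, so any bound on the levels that move the path is
    enough fuel. *)
Lemma reg_recP fuel pi : is_path n pi ->
  (forall z, reg (gap z) pi <> pi -> z < fuel) ->
  exists Z eta, regchain Z pi eta /\ reg_rec e p fuel pi = (Z, eta).
Proof.
elim: fuel pi => [|fuel IH] pi P H.
  exists [::], pi; split=> //; constructor => z.
  by apply/eqP; apply: contraT => /eqP /H.
rewrite /=.
set zs := [seq z <- _ | _].
have mz z : (z \in zs) = (reg (gap z) pi != pi).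
  rewrite mem_filter mem_iota /=; case: eqP => //= /(reg_small P).
  by case: P => -> _ _.
have srt : sorted ltn zs.
  exact: (sorted_filter ltn_trans _ (iota_ltn_sorted _ _)).
case Ez : zs => [|z0 zs'].
  exists [::], pi; split=> //; constructor => z; apply/eqP.
  by have := mz z; rewrite Ez in_nil; case: eqP.
rewrite -Ez; set z := last 0 zs.
have zin : z \in zs by rewrite /z Ez; exact: (mem_last z0 zs').
have ne : reg (gap z) pi <> pi by apply/eqP; rewrite -mz.
have fx z' : z < z' -> reg (gap z') pi = pi.
  move=> lt; apply/eqP; apply: contraTT lt; rewrite -mz => hz'.
  rewrite -leqNgt /z -nth_last -{1}(nth_index 0 hz').
  have hi : index z' zs < size zs by rewrite index_mem.
  apply: (sorted_leq_nth leq_trans leqnn) => //; try by rewrite inE; lia.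
  - by apply: sub_sorted srt => x y; apply: ltnW.
  - lia.
have Pr := reg_path (gap_gt1 z) P.
have [|Z [eta [ch E]]] := IH (reg (gap z) pi) Pr.
  move=> z' ne'; have := H z ne.
  have : z' < z; last by lia.
  by rewrite ltnNge; apply/negP => /(reg_step_fixed P ne fx).
exists (z :: Z), eta; split; first by constructor.
by rewrite -/(gap z) E.
Qed.

Lemma chain_reg pi : is_path n pi -> regchain (reg_set e p pi) pi (reg_ep e p pi).
Proof.
move=> P; rewrite /reg_set /reg_ep (_ : (p == 0) = false); last by lia.
have [|Z [eta [ch ->]]] // := @reg_recP (size pi) pi P.
by move=> z /(reg_small P); case: P => -> _ _.
Qed.

Lemma chain_regE Z pi eta : is_path n pi -> regchain Z pi eta ->
  reg_set e p pi = Z /\ reg_ep e p pi = eta.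
Proof. by move=> P; apply: chain_fun; apply: chain_reg. Qed.

Lemma reg_ep_regular pi : is_path n pi -> reg_ep e p pi = pi <-> regular pi.
Proof.
move=> P; split=> [E|R].
  by have [_ R _] := chain_inv (chain_reg P) P; rewrite E in R.
by have [_ ->] := chain_regE P (Chain_nil R).
Qed.

(** Each mirroring reverses all steps after its mirror, and the last visits to
    walls may be read off from the final path. *)
Lemma chain_up Z pi eta c : regchain Z pi eta -> is_path n pi -> c < n ->
  up eta c = up pi c (+) odd (count (fun z => lastwall (gap z) eta <= c) Z).
Proof.
elim=> {Z pi eta} [pi R P _|z Z pi eta ne fx ch IH P cn] /=; first by rewrite addbF.
have Pr := reg_path (gap_gt1 z) P.
rewrite IH // oddD oddb addbA; congr (_ (+) _).
rewrite (chain_lastwall _ ch Pr) lastwall_reg_gap //.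
have [_ _ B] := below_down (gap_gt1 z) P ne.
have -> : reg (gap z) pi = mirror_after (lastwall (gap z) pi) pi.
  rewrite (@regE n) ?gap_gt1 //; move/eqP: ne.
  by rewrite (@reg_neq n) ?gap_gt1 // => /negbTE ->.
by apply: (up_mirror_after P cn) => c' /B; lia.
Qed.

End Chain.

(** * The arc reflections of the map rho *)

Section Rho.

Variables (e p n : nat).
Hypotheses (e1 : 1 < e) (p1 : 1 < p).
Implicit Types (pi eta : seq nat) (Z : seq nat).

Local Notation gap := (gap e p).
Local Notation regular := (regular e p).

Lemma gap0 : gap 0 = e.
Proof. by rewrite /gap expn0 muln1. Qed.

(** Whether the steps from [c] on were reversed an odd number of times by the
    mirrorings of levels [Z], where [eta] is the final path. *)
Definition mirrored Z eta c : bool := odd (count (fun z => lastwall (gap z) eta <= c) Z).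

Section Arcs.
Variable eta : seq nat.
Hypothesis P : is_path n eta.
Local Notation B := (walls e eta).
Local Notation b := (nth 0 (walls e eta)).

Variable Z : seq nat.

(** The last visits to walls of all levels are visits to walls of level 0, so
    none of them is inside an arc. *)
Lemma lastwall_arc k z : k.+1 < size B -> b k < lastwall (gap z) eta ->
  b k.+1 <= lastwall (gap z) eta.
Proof.
move=> hk lt.
have ne : lastwall (gap z) eta <> 0 by lia.
have wB : lastwall (gap z) eta \in B.
  have := lastwall_mem ne; rewrite !mem_walls => /andP[-> h] /=.
  by apply: dvdn_trans h; rewrite -{1}gap0; apply: gap_dvd.
have hi : index (lastwall (gap z) eta) B < size B by rewrite index_mem.
have E : b (index (lastwall (gap z) eta) B) = _ := nth_index 0 wB; rewrite -E in lt *.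
apply: wall_leq => //; rewrite ltnNge; apply/negP => hle.
have := @wall_leq e eta (index (lastwall (gap z) eta) B) k ltac:(lia) hle; lia.
Qed.

Lemma mirrored_arc k c : k.+1 < size B -> b k <= c < b k.+1 ->
  mirrored Z eta c = mirrored Z eta (b k).
Proof.
move=> hk hc; rewrite /mirrored; congr odd; apply: eq_count => z.
apply/idP/idP => h; last by lia.
by rewrite leqNgt; apply/negP => /(lastwall_arc hk); lia.
Qed.

(** The positions [w i] are increasing because the levels decrease. So an arc
    lies between [w i] and [w (i + 1)] for at most one [i], which is the number
    of the [w i] up to its start. *)
Lemma reflected_arcE k : sorted gtn Z -> k.+1 < size B ->
  reflected_arc e p Z eta k =
  (nth 0 eta (b k) == nth 0 eta (b k.+1)) && mirrored Z eta (b k).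
Proof.
move=> srtZ hk; rewrite /reflected_arc; congr (_ && _).
set L := [seq last 0 (walls (p ^ z * e) eta) | z <- Z].
have sL : size L = size Z by rewrite size_map.
have LE : L = [seq lastwall (gap z) eta | z <- Z].
  by apply: eq_map => z; rewrite /lastwall /gap mulnC.
have srtL : sorted leq L.
  rewrite LE sorted_map.
  apply: sub_sorted srtZ => z z' /= /ltnW h; exact: lastwall_mono.
have nc j := @sorted_nth_count L (b k) j srtL.
have ms := count_size (fun x => x <= b k) L.
have -> : mirrored Z eta (b k) = odd (count (fun x => x <= b k) L).
  by rewrite LE count_map.
set m := count _ L in nc ms *; rewrite -sL.
have lt := wall_lt hk (ltnSn k).
have W1 i : 0 < i -> i <= size L -> nth 0 (0 :: rcons L (last 0 B)) i = nth 0 L i.-1.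
  by case: i => // i _ h /=; rewrite nth_rcons h.
have W2 : nth 0 (0 :: rcons L (last 0 B)) (size L).+1 = last 0 B.
  by rewrite /= nth_rcons ltnn eqxx.
have hb := wall_le_last hk; rewrite /lastwall in hb.
have U (i : nat) : 0 < i -> i <= size L ->
    nth 0 (0 :: rcons L (last 0 B)) i <= b k ->
    b k.+1 <= nth 0 (0 :: rcons L (last 0 B)) i.+1 -> m = i.
  move=> i0 ih; rewrite W1 // => w1 w2.
  have h1 : i <= m.
    have := nc i.-1 ltac:(lia); rewrite w1 => /esym; lia.
  have [lti|gei] := ltnP i (size L); last by lia.
  move: w2; rewrite W1 // => w2; have := nc i lti; rewrite /= in w2; lia.
apply/hasP/idP => [[i]|om].
  rewrite mem_iota => /andP[i0 ih] /and3P[oi w1 w2].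
  by rewrite (U i i0 ih w1 w2).
have m0 : 0 < m by case: (m) om.
exists m; first by rewrite mem_iota m0 add1n ltnS.
rewrite om W1 //= nc; last by lia.
rewrite prednK // leqnn /=.
have [lti|gei] := ltnP m (size L).
  rewrite nth_rcons lti.
  have := nc m lti; rewrite ltnn LE (nth_map 0) -?sL // => /negbT.
  by rewrite -ltnNge; apply: lastwall_arc.
have -> : m = size L by lia.
by rewrite nth_rcons ltnn eqxx.
Qed.

Lemma size_rho : size (rho e p Z eta) = size eta.
Proof. by rewrite /rho; case: eqP => // _; rewrite size_mkseq. Qed.

Lemma rhoE c : c <= n -> nth 0 (rho e p Z eta) c =
  if [seq k <- iota 0 (size B).-1
                 | reflected_arc e p Z eta k && (b k <= c <= b k.+1)] is k :: _
  then 2 * nth 0 eta (b k) - nth 0 eta c else nth 0 eta c.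
Proof.
move=> hc; rewrite /rho (_ : (p == 0) = false); last by lia.
by rewrite nth_mkseq //; case: P => -> _ _.
Qed.

(** The list of reflected arcs containing [c] may start with a neighbour of the
    arc [k]; then [c] is a common endpoint, which both reflections fix. *)
Lemma rho_arc k c : k.+1 < size B -> b k <= c <= b k.+1 ->
  nth 0 (rho e p Z eta) c =
  if reflected_arc e p Z eta k then 2 * nth 0 eta (b k) - nth 0 eta c
  else nth 0 eta c.
Proof.
move=> hk hc; have ln := wall_le_n P hk.
rewrite rhoE; last by lia.
set ks := [seq _ <- _ | _].
have mk k' : (k' \in ks) =
    [&& reflected_arc e p Z eta k', b k' <= c <= b k'.+1 & k'.+1 < size B].
  by rewrite mem_filter mem_iota -andbA; congr [&& _, _ & _]; lia.
case E : ks => [|k' ks'].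
  by have := mk k; rewrite E in_nil hc hk !andbT => <-.
have := mk k'; rewrite {1}E mem_head => /esym/and3P[r' hc' hk'].
have [Ek|ne] := eqVneq k' k; first by rewrite -Ek r'.
have /eqP Er' : nth 0 eta (b k') == nth 0 eta (b k'.+1) by case/andP: r'.
have Er : reflected_arc e p Z eta k -> nth 0 eta (b k) = nth 0 eta (b k.+1).
  by case/andP => /eqP.
have [Ec|Ec] : (c = b k /\ c = b k'.+1) \/ (c = b k' /\ c = b k.+1).
- have [lt|lt|E'] := ltngtP k' k; last by rewrite E' eqxx in ne.
    left; have := @wall_leq e eta k'.+1 k ltac:(lia) lt; lia.
  right; have := @wall_leq e eta k.+1 k' ltac:(lia) lt; lia.
- rewrite Er' -{1}Ec.2 Ec.1; case: ifP => _; lia.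
- rewrite -Ec.1; case: ifP => [/Er ->|_]; rewrite -?Ec.2; lia.
Qed.

Lemma rho_out c : c <= n -> (forall k, k.+1 < size B -> ~~ (b k <= c <= b k.+1)) ->
  nth 0 (rho e p Z eta) c = nth 0 eta c.
Proof.
move=> hc H; rewrite rhoE //.
set ks := [seq _ <- _ | _]; case E : ks => [//|k ks'].
have : k \in ks by rewrite E mem_head.
rewrite mem_filter mem_iota => /andP[/andP[_ h1] h2].
by have := H k; rewrite h1 => /(_ ltac:(lia)).
Qed.

Lemma rho_before c : c <= n -> (forall k, k < size B -> c < b k) ->
  nth 0 (rho e p Z eta) c = nth 0 eta c.
Proof.
by move=> hc H; apply: rho_out => // k hk; have := H k; lia.
Qed.

Lemma rho_wall c : c \in B -> nth 0 (rho e p Z eta) c = nth 0 eta c.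
Proof.
move=> cB; have hi : index c B < size B by rewrite index_mem.
have E : b (index c B) = c := nth_index 0 cB.
have cn : c <= n by move: cB; rewrite mem_walls; case: P => -> _ _; rewrite ltnS => /andP[].
have [lt|ge] := ltnP (index c B).+1 (size B).
  rewrite (@rho_arc (index c B)) // E.
    by case: ifP => // _; lia.
  by rewrite leqnn; have := wall_lt lt (ltnSn _); lia.
have [|B1] := posnP (index c B); last first.
  have lt : (index c B).-1.+1 < size B by lia.
  rewrite (@rho_arc (index c B).-1) //; last first.
    by rewrite prednK // E leqnn andbT; have := @wall_lt e eta (index c B).-1 (index c B) hi; lia.
  case: ifP => // /andP[/eqP]; rewrite prednK // E => -> _; lia.
by move=> i0; apply: rho_out => // k hk; lia.
Qed.

Lemma rho_after c : 0 < size B -> lastwall e eta <= c <= n ->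
  nth 0 (rho e p Z eta) c = nth 0 eta c.
Proof.
move=> sB /andP[h1 h2]; have [E|ne] := eqVneq c (lastwall e eta).
  by apply: rho_wall; rewrite E last_wall_nth // mem_nth // ltn_predL.
have lt : lastwall e eta < c by rewrite ltn_neqAle eq_sym ne.
apply: rho_out => // k hk; have := wall_le_last hk; lia.
Qed.

Lemma rho_step c : c < n ->
  (nth 0 (rho e p Z eta) c = nth 0 eta c /\
   nth 0 (rho e p Z eta) c.+1 = nth 0 eta c.+1) \/
  exists k, [/\ k.+1 < size B, b k <= c < b k.+1 & reflected_arc e p Z eta k].
Proof.
move=> hc; case: (arcP e eta c) => [k hk hck|H|sB h].
- case hr: (reflected_arc e p Z eta k); first by right; exists k.
  left; rewrite !(@rho_arc k) ?hr //; lia.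
- left; split; first by apply: rho_before => //; lia.
  have [h|h] := boolP (c.+1 \in B); first exact: rho_wall.
  apply: rho_before => // k hk; have := H k hk.
  rewrite leq_eqVlt => /predU1P[E|//].
  by move: h; rewrite E mem_nth.
- by left; split; apply: rho_after; lia.
Qed.

(** Additive form, in which the subtraction is seen to be exact. *)
Lemma rho_arc_sum k c : k.+1 < size B -> reflected_arc e p Z eta k ->
  b k <= c <= b k.+1 ->
  nth 0 (rho e p Z eta) c + nth 0 eta c = 2 * nth 0 eta (b k).
Proof.
move=> hk hr hc; rewrite (rho_arc hk hc) hr.
have /eqP E : nth 0 eta (b k) == nth 0 eta (b k.+1) by case/andP: hr.
have := arc_bounds P hk E hc; lia.
Qed.

Lemma rho_path : is_path n (rho e p Z eta).
Proof.
have [sz z0 st] := P; split; first by rewrite size_rho.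
  by rewrite rho_before // => k; apply: (wall_pos P e1).
move=> c hc; have := st c hc; case: (rho_step hc) => [[-> ->] //|[k [hk hck hr]]].
have := @rho_arc_sum k c hk hr ltac:(lia).
have := @rho_arc_sum k c.+1 hk hr ltac:(lia); lia.
Qed.

Lemma rho_point c : c <= n -> nth 0 (rho e p Z eta) c = nth 0 eta c \/
  exists2 k, k.+1 < size B & nth 0 (rho e p Z eta) c + nth 0 eta c = 2 * nth 0 eta (b k).
Proof.
move=> hc; case: (arcP e eta c) => [k hk hck|H|sB h].
- case hr: (reflected_arc e p Z eta k).
    by right; exists k => //; apply: rho_arc_sum; lia.
  by left; rewrite (@rho_arc k) ?hr //; lia.
- by left; apply: rho_before.
- by left; apply: rho_after; rewrite ?h.
Qed.

Lemma walls_rho : walls e (rho e p Z eta) = B.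
Proof.
have [sz _ _] := P.
apply: walls_ext; rewrite size_rho // sz => c; rewrite ltnS => hc.
have [->//|[k hk E]] := rho_point hc.
apply: (@dvdn_reflect _ _ _ (nth 0 eta (b k))); last by lia.
by apply: wall_dvd; lia.
Qed.

(** Every visit to a wall of level [z] is a visit to a wall of level 0, before
    and after, and there the path does not move. *)
Lemma walls_rho_gap z : walls (gap z) (rho e p Z eta) = walls (gap z) eta.
Proof.
have [sz _ _] := P.
have ed : e %| gap z by rewrite -{1}gap0; apply: gap_dvd.
apply: walls_ext; rewrite size_rho // sz => c; rewrite ltnS => hc.
have [cB|] := boolP (c \in B); first by rewrite rho_wall.
rewrite -{1}walls_rho !mem_walls size_rho sz ltnS hc /= => h1.
have [cB|] := boolP (c \in B).
  by move: cB; rewrite -walls_rho mem_walls (negbTE h1) andbF.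
rewrite mem_walls sz ltnS hc /= => h2.
by apply/idP/idP => /(dvdn_trans ed); rewrite ?(negbTE h1) ?(negbTE h2).
Qed.

Lemma rho_n : nth 0 (rho e p Z eta) n = nth 0 eta n.
Proof.
case: (arcP e eta n) => [k hk hck|H|sB h].
- have := wall_le_n P hk; lia.
- exact: rho_before.
- by apply: rho_after; rewrite ?h ?leqnn.
Qed.

Lemma last_rho : last 0 (rho e p Z eta) = last 0 eta.
Proof. by rewrite (path_last rho_path) (path_last P) rho_n. Qed.

(** Regularity only depends on the end of the path and on its last walls. *)
Lemma rho_regular : regular eta -> regular (rho e p Z eta).
Proof.
move=> R z; apply/eqP.
rewrite (@reg_neq n) ?gap_gt1 //; last exact: rho_path.
have -> : lastwall (gap z) (rho e p Z eta) = lastwall (gap z) eta.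
  by rewrite /lastwall walls_rho_gap.
have /eqP := R z; rewrite (@reg_neq n) ?gap_gt1 // last_rho.
have [->|ne] := eqVneq (lastwall (gap z) eta) 0.
  by case: rho_path => _ -> _.
rewrite rho_wall //.
have := lastwall_mem (elimN eqP ne); rewrite !mem_walls => /andP[-> h] /=.
by apply: dvdn_trans h; rewrite -{1}gap0; apply: gap_dvd.
Qed.

Lemma up_rho k : k.+1 < size B ->
  up (rho e p Z eta) (b k) = up eta (b k) (+) reflected_arc e p Z eta k.
Proof.
move=> hk; have lt := wall_lt hk (ltnSn k); have ln := wall_le_n P hk.
have [_ _ st] := P; have := st (b k) ltac:(lia).
case hr: (reflected_arc e p Z eta k); rewrite /up; last first.
  by rewrite !(@rho_arc k) ?hr ?addbF //; lia.
have := @rho_arc_sum k (b k) hk hr ltac:(lia).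
have := @rho_arc_sum k (b k).+1 hk hr ltac:(lia).
rewrite addbT; lia.
Qed.

End Arcs.

(** Which arcs are reflected depends only on the walls and on the heights
    there, and these do not change. *)
Lemma rho_invol Z eta : sorted gtn Z -> is_path n eta ->
  rho e p Z (rho e p Z eta) = eta.
Proof.
move=> sZ P; have Pr := rho_path P Z; have [sz _ _] := P.
have W := walls_rho P Z.
have T c : mirrored Z (rho e p Z eta) c = mirrored Z eta c.
  by rewrite /mirrored; congr odd; apply: eq_count => z; rewrite /lastwall (walls_rho_gap P).
apply: (path_ext P); first by rewrite !size_rho.
move=> c hc; case: (arcP e eta c) => [k hk hck|H|sB h].
- have hc' : nth 0 (walls e eta) k <= c <= nth 0 (walls e eta) k.+1 by lia.
  rewrite (@rho_arc _ Pr Z k) ?W // (rho_arc P Z hk hc').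
  rewrite !reflected_arcE ?W // T.
  have w1 : nth 0 (walls e eta) k \in walls e eta := mem_nth 0 (ltnW hk).
  have w2 : nth 0 (walls e eta) k.+1 \in walls e eta := mem_nth 0 hk.
  rewrite !(rho_wall P Z) //; case h: (_ && _) => //.
  have /eqP E : nth 0 eta (nth 0 (walls e eta) k) ==
    nth 0 eta (nth 0 (walls e eta) k.+1) by case/andP: h.
  have := arc_bounds P hk E hc'; lia.
- rewrite (rho_before Pr) ?(rho_before P) // W //.
- by rewrite (rho_after Pr) ?(rho_after P) ?W // /lastwall ?W h.
Qed.

End Rho.

(** * Degrees and residues along a path *)

(** The contribution of step [c] to the degree: up steps add nodes of degree 0
    in the first column. *)
Definition step_deg (e : nat) (pi : seq nat) (c : nat) : int :=
  if up pi c then 0%R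
  else ((e %| (nth 0 pi c).+1)%:Z - (e %| (nth 0 pi c.+1).+1)%:Z)%R.

Definition path_deg (e : nat) (pi : seq nat) (u v : nat) : int :=
  (\sum_(u <= c < v) step_deg e pi c)%R.

(** With [h] the height after [c] steps, the columns have lengths [(c + h) / 2]
    and [(c - h) / 2]. *)
Definition path_res (e : nat) (pi : seq nat) (c : nat) : 'Z_e :=
  if up pi c then (- ((c + nth 0 pi c)./2)%:R)%R
  else (1 - ((c - nth 0 pi c)./2)%:R)%R.

Lemma dvdn_close d x y : d %| x -> d %| y -> x <= y < x + d -> x = y.
Proof.
move=> dx dy /andP[h1 h2]; have : d %| y - x by rewrite dvdn_sub.
move=> /dvdn_leq; case: (posnP (y - x)) => [|h /(_ isT)]; lia.
Qed.

Section Degree.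

Variables (e n : nat).
Hypothesis (e1 : 1 < e).
Implicit Types (pi eta : seq nat).

Lemma path_degS pi u v : u <= v ->
  path_deg e pi u v.+1 = (path_deg e pi u v + step_deg e pi v)%R.
Proof. by move=> h; rewrite /path_deg big_nat_recr. Qed.

Lemma path_deg_cat pi u v w : u <= v -> v <= w ->
  path_deg e pi u w = (path_deg e pi u v + path_deg e pi v w)%R.
Proof. by move=> h1 h2; rewrite /path_deg (big_cat_nat h1 h2). Qed.

(** Inside a piece between walls only its first step contributes, provided that
    it leaves the wall downwards. *)
Lemma deg_inside pi u v c : is_path n pi -> v <= n.+1 -> e %| (nth 0 pi u).+1 ->
  (forall c, u < c < v -> ~~ (e %| (nth 0 pi c).+1)) ->
  u < c < v -> path_deg e pi u c = ((~~ up pi u)%:Z)%R.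
Proof.
move=> P hv du nw; elim: c => [//|c IH] hc.
have := nw c.+1 hc => nc1.
have [lt|lt|E] := ltngtP u c; last first.
- subst c; rewrite path_degS // /path_deg big_geq // add0r /step_deg du (negbTE nc1).
  by case: up; rewrite ?subr0.
- lia.
have hc' : u < c < v by lia.
rewrite path_degS ?IH //; last by lia.
by rewrite /step_deg (negbTE nc1) (negbTE (nw c hc')); case: (up pi c); rewrite ?subrr addr0.
Qed.

(** The first step contributes [1] if it goes down and the last one [-1] if it
    goes down. The piece returns to its wall exactly if these two directions
    differ. *)
Lemma arc_deg pi u v : is_path n pi -> u < v <= n -> e %| (nth 0 pi u).+1 ->
  e %| (nth 0 pi v).+1 -> (forall c, u < c < v -> ~~ (e %| (nth 0 pi c).+1)) ->
  path_deg e pi u v = (if nth 0 pi u == nth 0 pi v then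
    (if up pi u then -1 else 1) else 0)%R /\
  (nth 0 pi u == nth 0 pi v) = (up pi u != up pi v.-1).
Proof.
move=> P /andP[uv vn] du dv nw; have [_ _ st] := P.
have uv1 : u.+1 < v.
  rewrite ltn_neqAle uv andbT; apply/eqP => E; move: dv; rewrite -E => dv.
  have := st u ltac:(lia); case=> F.
    have := @dvdn_close e (nth 0 pi u).+1 (nth 0 pi u.+1).+1 du dv; lia.
  have := @dvdn_close e (nth 0 pi u.+1).+1 (nth 0 pi u).+1 dv du; lia.
case: v uv vn dv nw uv1 => [//|v] uv vn dv nw uv1 /=.
have hin : u < v < v.+1 by lia.
rewrite path_degS; last by lia.
rewrite (deg_inside P (leqW vn) du nw hin).
rewrite /step_deg dv (negbTE (nw v hin)).
have s := st v vn.
have [hu|hu] := boolP (up pi u).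
  have b := confine_up P (leqW vn) du hu nw hin.
  case hv : (up pi v); rewrite /up in hv.
    have -> : (nth 0 pi u == nth 0 pi v.+1) = false by lia.
    by [].
  have E := @dvdn_close e (nth 0 pi u).+1 (nth 0 pi v.+1).+1 du dv ltac:(lia).
  by case: E => ->; rewrite eqxx.
have un : u < n by lia.
have b := confine_dn P (leqW vn) un du hu nw hin.
case hv : (up pi v); rewrite /up in hv.
  have E := @dvdn_close e (nth 0 pi v.+1).+1 (nth 0 pi u).+1 dv du ltac:(lia).
  by case: E => ->; rewrite eqxx.
have -> : (nth 0 pi u == nth 0 pi v.+1) = false by lia.
by [].
Qed.

Lemma height_before pi v c : is_path n pi -> v <= n.+1 ->
  (forall c, c < v -> ~~ (e %| (nth 0 pi c).+1)) -> c < v -> (nth 0 pi c).+1 < e.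
Proof.
move=> [_ z0 st] hv nw; elim: c => [|c IH] hc; first by rewrite z0.
have ne : (nth 0 pi c.+1).+1 <> e by move=> E; have := nw _ hc; rewrite E dvdnn.
have := IH ltac:(lia); have := st c ltac:(lia); lia.
Qed.

(** Below the first wall no step touches a wall except the one that reaches it,
    and that goes up. *)
Lemma deg_before pi v : is_path n pi -> v <= n ->
  (forall c, c < v -> ~~ (e %| (nth 0 pi c).+1)) -> path_deg e pi 0 v = 0%R.
Proof.
move=> P vn nw; have hb c := height_before (c := c) P (leqW vn) nw.
have [_ _ st] := P.
rewrite /path_deg big_nat big1 // => c /andP[_ hc]; rewrite /step_deg.
case hu: (up pi c) => //; rewrite /up in hu.
rewrite (negbTE (nw c hc)).
have h : (nth 0 pi c.+1).+1 < e by have := hb c hc; lia.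
by rewrite gtnNdvd.
Qed.

(** The piece after the last wall contributes through its first step, and going
    down there means that [reg e] moves the path. *)
Lemma path_degE pi : is_path n pi ->
  path_deg e pi 0 n = (path_deg e pi 0 (lastwall e pi) + (r_path e pi)%:Z)%R.
Proof.
move=> P; have ln := lastwall_le e P; have [_ z0 _] := P.
rewrite /r_path (reg_neq e1 P) (path_last P).
have [E|ne] := eqVneq (lastwall e pi) 0.
  rewrite E z0 /= {2}/path_deg big_geq // deg_before // => c hc.
  have [->|c0] := posnP c; first by rewrite z0 dvdn1; lia.
  by apply: (after_lastwall P); rewrite E c0 ltnW.
rewrite (path_deg_cat _ (leq0n _) ln); congr (_ + _)%R.
have [E|lt] : lastwall e pi = n \/ lastwall e pi < n by lia.
  by rewrite {1}E /path_deg big_geq // E leqnn.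
have dw := lastwall_dvd (elimN eqP ne).
have nw c : lastwall e pi < c < n.+1 -> ~~ (e %| (nth 0 pi c).+1).
  by move=> hc; apply: (after_lastwall P).
have hin : lastwall e pi < n < n.+1 by lia.
rewrite (deg_inside P (leqnn _) dw nw hin).
case hu: (up pi (lastwall e pi)).
  have := confine_up P (leqnn _) dw hu nw hin => b.
  by have -> : nth 0 pi (lastwall e pi) <= nth 0 pi n by lia.
have := confine_dn P (leqnn _) lt dw (negbT hu) nw hin => b.
by have -> : (nth 0 pi (lastwall e pi) <= nth 0 pi n) = false by lia.
Qed.

(** Up to the last wall, the degree only depends on which pieces return to
    their wall and on which side of it they run. *)
Lemma path_deg_eq pi zeta : is_path n pi -> is_path n zeta ->
  walls e zeta = walls e pi ->
  (forall k, k.+1 < size (walls e pi) ->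
    let u := nth 0 (walls e pi) k in let v := nth 0 (walls e pi) k.+1 in
    (nth 0 zeta u == nth 0 zeta v) = (nth 0 pi u == nth 0 pi v) /\
    (nth 0 pi u = nth 0 pi v -> up zeta u = up pi u)) ->
  path_deg e zeta 0 (lastwall e zeta) = path_deg e pi 0 (lastwall e pi).
Proof.
move=> P P' W H.
have [B0|sB] := posnP (size (walls e pi)).
  by rewrite /lastwall W (size0nil B0) /path_deg !big_geq.
rewrite !last_wall_nth ?W //.
suff D k : k < size (walls e pi) -> path_deg e zeta 0 (nth 0 (walls e pi) k) =
                                  path_deg e pi 0 (nth 0 (walls e pi) k).
  by apply: D; rewrite ltn_predL.
elim: k => [|k IH] hk.
  have nw eta : is_path n eta -> walls e eta = walls e pi ->
    forall c, c < nth 0 (walls e pi) 0 -> ~~ (e %| (nth 0 eta c).+1).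
    move=> Q E c hc; apply/negP => dc.
    have : c \in walls e pi.
      rewrite -E mem_walls dc andbT; case: Q => -> _ _.
      by have := wall_le_n P hk; lia.
    move=> /(nthP 0)[i hi Ei].
    have := wall_leq (eta := pi) hi (leq0n i); rewrite Ei; lia.
  rewrite (deg_before P' (wall_le_n P hk) (nw _ P' W)).
  by rewrite (deg_before P (wall_le_n P hk) (nw _ P erefl)).
have hk' := ltnW hk.
have lt := wall_lt (eta := pi) hk (ltnSn k).
rewrite !(path_deg_cat _ (leq0n _) (ltnW lt)) IH //; congr (_ + _)%R.
have hn : nth 0 (walls e pi) k < nth 0 (walls e pi) k.+1 <= n.
  by rewrite lt (wall_le_n P hk).
have [h1 h2] := H k hk.
have [-> _] := arc_deg P hn (wall_dvd hk') (wall_dvd hk) (fun c => wall_between P hk).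
have hkz : k.+1 < size (walls e zeta) by rewrite W.
have := arc_deg P'; move: (hn); rewrite -W => hn' /(_ _ _ hn').
move/(_ (wall_dvd (ltnW hkz)) (wall_dvd hkz) (fun c => wall_between P' hkz)).
case=> -> _; rewrite W h1; case: eqP => // E.
by rewrite h2.
Qed.

Lemma path_parity pi c : is_path n pi -> c <= n -> ~~ odd (c + nth 0 pi c).
Proof.
case=> _ z0 st; elim: c => [|c IH] hc; first by rewrite z0.
have := IH (ltnW hc); case: (st c hc) => E; rewrite ?E ?addSn ?addnS /= ?negbK //; lia.
Qed.

Lemma natr_wall v : e %| v.+1 -> (v%:R = -1 :> 'Z_e)%R.
Proof.
move=> /eqP dv; apply/eqP; rewrite -addr_eq0 natr1 -(Zp_nat_mod e1) dv.
by [].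
Qed.

(** Mirroring exchanges up and down, and exchanges the two column lengths up to
    a multiple of [e] minus 1, which is just what makes the residues agree. *)
Lemma path_res_mirror pi zeta c v : is_path n pi -> is_path n zeta -> c < n ->
  e %| v.+1 -> nth 0 pi c + nth 0 zeta c = 2 * v ->
  nth 0 pi c.+1 + nth 0 zeta c.+1 = 2 * v -> path_res e pi c = path_res e zeta c.
Proof.
wlog hu : pi zeta / up pi c.
  move=> W P P' cn dv E1 E2; case hu: (up pi c); first exact: W dv E1 E2.
  apply/esym; apply: (W zeta pi _ P' P cn dv); rewrite 1?addnC //.
  case: P P' => _ _ st [_ _ st']; move: hu; rewrite /up.
  by have := st c cn; have := st' c cn; lia.
move=> P P' cn dv E1 E2.
have hz : up zeta c = false.
  case: P P' => _ _ st [_ _ st']; move: hu; rewrite /up.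
  by have := st c cn; have := st' c cn; lia.
have l1 := path_height P (ltnW cn); have l2 := path_height P' (ltnW cn).
have p1 := path_parity P (ltnW cn); have p2 := path_parity P' (ltnW cn).
rewrite /path_res hu hz.
have -> : (c + nth 0 pi c)./2 = v + (c - nth 0 zeta c)./2 by lia.
by rewrite natrD natr_wall // opprD opprK.
Qed.

Lemma path_res_eq pi zeta c : nth 0 pi c = nth 0 zeta c ->
  nth 0 pi c.+1 = nth 0 zeta c.+1 -> path_res e pi c = path_res e zeta c.
Proof. by rewrite /path_res /up => -> ->. Qed.

Lemma path_res_reg d pi c : 1 < d -> e %| d -> is_path n pi -> c < n ->
  path_res e (reg d pi) c = path_res e pi c.
Proof.
move=> d1 ed P cn; have [->//|ne] := reg d pi =P pi.
have [/andP[w0 wn] dw B] := below_down d1 P ne.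
have Pr := reg_path d1 P.
have R c' := nth_reg (c := c') d1 P ne.
have [h|h] := ltnP c (lastwall d pi).
  by apply: path_res_eq; rewrite R ?h ?(ltnW h) // ltnW.
apply: (path_res_mirror (v := nth 0 pi (lastwall d pi)) Pr P cn).
- exact: dvdn_trans dw.
- rewrite R ?(ltnW cn) //; case: leqP => hc; last by have := B c; lia.
  have -> : c = lastwall d pi by lia.
  lia.
- rewrite R // (leqNgt c.+1) ltnS h /=; have := B c.+1; lia.
Qed.

End Degree.

Section PathTheorem.

Variables (e p n : nat).
Hypotheses (e1 : 1 < e) (p1 : 1 < p).
Implicit Types (pi eta : seq nat) (Z : seq nat).

Local Notation gap := (gap e p).
Local Notation regular := (regular e p).
Local Notation regchain := (regchain e p).
Local Notation mirrored := (mirrored e p).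

Lemma chain_res Z pi eta c : regchain Z pi eta -> is_path n pi -> c < n ->
  path_res e eta c = path_res e pi c.
Proof.
elim=> {Z pi eta} [//|z Z pi eta ne fx ch IH P cn].
have ed : e %| gap z by rewrite -{1}(gap0 e p); apply: gap_dvd.
by rewrite IH ?(path_res_reg e1 _ ed P) ?gap_gt1 //; apply: reg_path; rewrite ?gap_gt1.
Qed.

Lemma rho_res Z eta c : is_path n eta -> c < n ->
  path_res e (rho e p Z eta) c = path_res e eta c.
Proof.
move=> P cn; have Pr := rho_path e1 p1 P Z.
have [[E1 E2]|[k [hk hc hr]]] := rho_step e1 p1 P Z cn; first exact: path_res_eq.
apply: (path_res_mirror e1 Pr P cn (wall_dvd (ltnW hk))).
  by apply: (rho_arc_sum e1 p1 P hk hr); case/andP: hc => -> /ltnW ->.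
by apply: (rho_arc_sum e1 p1 P hk hr); case/andP: hc => /leqW -> ->.
Qed.

(** Every level has its last wall visit no later than level 0 has. *)
Lemma mirrored_last Z eta : mirrored Z eta (lastwall e eta) = odd (size Z).
Proof.
rewrite /mirrored -count_predT; congr odd; apply: eq_count => z /=.
by rewrite -[e in X in _ <= X](gap0 e p) lastwall_mono.
Qed.

(** The final path runs upwards after its last wall of level 0, if it does not
    stop there. So the direction in which [pi] leaves this wall is given by the
    number of mirrorings. As the right-hand side only involves the end of [eta]
    and [Z], the invariant [r_path e] is the same for all runs with these data.
    *)
Lemma chain_r_path Z pi eta : regchain Z pi eta -> is_path n pi ->
  r_path e pi = ~~ (e %| (last 0 eta).+1) && odd (size Z).
Proof.
move=> ch P; have [Pe Re W] := chain_inv e1 p1 ch P.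
have We : walls e eta = walls e pi by have := W 0; rewrite gap0.
have LW : lastwall e eta = lastwall e pi by rewrite /lastwall We.
have [sz z0 _] := P; have [sze ze0 _] := Pe.
rewrite /r_path (reg_neq e1 P) (path_last P).
have [E0|ne0] := eqVneq (lastwall e pi) 0.
  rewrite E0 z0 /=.
  suff -> : Z = [::] by rewrite andbF.
  case: ch W We LW => [//|z Z' pi' eta' ne _ _ _ _ _] in P E0 *.
  have [/andP[w0 _] _ _] := below_down (gap_gt1 e1 p1 z) P ne.
  have := lastwall_mono e1 p1 pi' (leq0n z); rewrite gap0 E0; lia.
have wpos : 0 < lastwall e pi by rewrite lt0n.
have ln := lastwall_le e P.
have [E|lt] : lastwall e pi = n \/ lastwall e pi < n by lia.
  rewrite E leqnn (path_last Pe).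
  have := lastwall_dvd (elimN eqP (_ : lastwall e eta != 0)); rewrite LW E => -> //.
  by rewrite -E.
have dw := lastwall_dvd (elimN eqP ne0).
have nw c : lastwall e pi < c < n.+1 -> ~~ (e %| (nth 0 pi c).+1).
  by move=> hc; apply: (after_lastwall P).
have hin : lastwall e pi < n < n.+1 by lia.
have ne : ~~ (e %| (last 0 eta).+1).
  by rewrite (path_last Pe); apply: (after_lastwall Pe); rewrite LW lt leqnn.
have U := chain_up e1 p1 ch P lt.
have := mirrored_last Z eta; rewrite LW /mirrored /mirrored => T; rewrite T in U.
have upe : up eta (lastwall e pi).
  have Re0 : reg e eta = eta by have := Re 0; rewrite gap0.
  have := above_up e1 Pe Re0 (c := (lastwall e pi).+1); rewrite LW wpos ltnSn.
  by move=> /(_ isT lt) /andP[].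
rewrite ne /=; rewrite upe in U.
have [hu|hu] := boolP (up pi (lastwall e pi)).
  have b := confine_up P (leqnn _) dw hu nw hin.
  have -> : nth 0 pi (lastwall e pi) <= nth 0 pi n by lia.
  by move: U; rewrite hu /=; case: odd.
have b := confine_dn P (leqnn _) lt dw hu nw hin.
have -> : (nth 0 pi (lastwall e pi) <= nth 0 pi n) = false by lia.
by move: U; rewrite (negbTE hu) /=; case: odd.
Qed.

(** By [path_deg_eq] only the sides of the returning pieces matter. From [pi]
    to [eta] a returning piece changes side if it was mirrored an odd number of
    times, and then [rho] brings it back. *)
Lemma rho_deg Z pi eta : regchain Z pi eta -> is_path n pi ->
  path_deg e pi 0 n = (path_deg e (rho e p Z eta) 0 n + (r_path e pi)%:Z)%R.
Proof.
move=> ch P; have [Pe Re W] := chain_inv e1 p1 ch P.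
have We : walls e eta = walls e pi by have := W 0; rewrite gap0.
have Pz := rho_path e1 p1 Pe Z.
have Wz := walls_rho e1 p1 Pe Z.
have sZ := chain_sorted e1 p1 ch P.
rewrite (path_degE e1 P) (path_degE e1 Pz).
have -> : r_path e (rho e p Z eta) = 0.
  rewrite /r_path; have := rho_regular e1 p1 Pe Z Re 0; rewrite gap0 => ->.
  by rewrite eqxx.
rewrite addr0; congr (_ + _)%R; apply/esym.
apply: (path_deg_eq e1 P Pz); first by rewrite Wz.
move=> k hk u v.
have hke : k.+1 < size (walls e eta) by rewrite We.
have lt := wall_lt hk (ltnSn k); have vn := wall_le_n P hk.
have uv : u < v <= n by rewrite lt.
have nw : forall c, u < c < v -> ~~ (e %| (nth 0 pi c).+1) by move=> c; apply: (wall_between P hk).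
have nwe : forall c, u < c < v -> ~~ (e %| (nth 0 eta c).+1).
  by move=> c; rewrite /u /v -We; apply: (wall_between Pe hke).
have due : e %| (nth 0 eta u).+1 by rewrite /u -We; apply: wall_dvd; apply: ltnW.
have dve : e %| (nth 0 eta v).+1 by rewrite /v -We; apply: wall_dvd.
have [_ rp] := arc_deg e1 P uv (wall_dvd (ltnW hk)) (wall_dvd hk) nw.
have [_ re] := arc_deg e1 Pe uv due dve nwe.
have U c : c < n -> up eta c = up pi c (+) mirrored Z eta c := chain_up e1 p1 ch P.
have T c : u <= c < v -> mirrored Z eta c = mirrored Z eta u.
  by rewrite /u /v -We; apply: mirrored_arc.
have ret : (nth 0 eta u == nth 0 eta v) = (nth 0 pi u == nth 0 pi v).
  have un : u < n by apply: leq_trans vn; case/andP: uv.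
  have vn' : v.-1 < n by lia.
  rewrite re rp !U // (T v.-1); last by lia.
  by case: up; case: up; case: mirrored.
have uB : u \in walls e eta by rewrite /u -We mem_nth // ltnW.
have vB : v \in walls e eta by rewrite /v -We mem_nth.
rewrite !(rho_wall e1 p1 Pe Z) //; split=> // E.
have := up_rho e1 p1 Pe Z hke; rewrite We -/u => ->.
have := reflected_arcE e1 p1 sZ hke; rewrite We -/u -/v => ->.
have un : u < n by apply: leq_trans lt vn.
by rewrite ret E eqxx /= (U u un) addbK.
Qed.

End PathTheorem.

(** * Diagrams with parts at most 2 *)

Lemma mem_nodes la a b :
  ((a, b) \in nodes la) = (0 < a) && (0 < b <= nth 0 la a.-1).
Proof.
apply/allpairsPdep/idP => [[x [y [hx hy [-> ->]]]]|].
  by move: hx hy; rewrite !mem_iota; lia.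
move=> /andP[a0 /andP[b0 hb]]; exists a, b; split=> //; rewrite mem_iota.
  have : ~~ (size la <= a.-1) by apply/negP => /(nth_default 0) E; rewrite E in hb; lia.
  lia.
lia.
Qed.

Lemma nodes_uniq la : uniq (nodes la).
Proof.
apply: allpairs_uniq_dep; rewrite ?iota_uniq //; first by move=> x _; apply: iota_uniq.
by move=> [x y] [x' y'] _ _ /= [-> ->].
Qed.

Lemma part_nth la i j : is_part la -> i <= j -> nth 0 la j <= nth 0 la i.
Proof.
move=> /andP[srt _] ij; have [lt|ge] := ltnP j (size la); last by rewrite nth_default.
have gt : transitive geq by move=> x y z h1 h2; apply: leq_trans h2 h1.
have gr : reflexive geq by move=> x; apply: leqnn.
by apply: (sorted_leq_nth gt gr 0 srt) => //; rewrite inE; lia.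
Qed.

Lemma part_pos la i : is_part la -> i < size la -> 0 < nth 0 la i.
Proof.
move=> /andP[_ n0] hi; rewrite lt0n; apply/eqP => E.
by move: n0; rewrite -E mem_nth.
Qed.

Lemma nodes_closed la a b a' b' : is_part la -> (a, b) \in nodes la ->
  0 < a' <= a -> 0 < b' <= b -> (a', b') \in nodes la.
Proof.
rewrite !mem_nodes => pl h ha hb.
have := @part_nth la a'.-1 a.-1 pl ltac:(lia); lia.
Qed.

(** The counts of nodes per row and the largest row index do not depend on the
    order of the nodes. *)
Lemma row_lengths_nodes la s : is_part la -> perm_eq s (nodes la) -> row_lengths s = la.
Proof.
move=> pl ps.
have cnt a : 0 < a -> count (fun A : node => A.1 == a) s = nth 0 la a.-1.
  move=> a0; rewrite (permP ps) -size_filter.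
  rewrite (@perm_size _ _ [seq (a, b) | b <- iota 1 (nth 0 la a.-1)]);
    first by rewrite size_map size_iota.
  apply: uniq_perm.
  - exact/filter_uniq/nodes_uniq.
  - by rewrite map_inj_uniq ?iota_uniq // => x y [].
  move=> [x b]; rewrite mem_filter mem_nodes /=.
  apply/idP/mapP => [|[y hy [-> ->]]].
    move=> /andP[/eqP -> h]; exists b => //; rewrite mem_iota; lia.
  move: hy; rewrite mem_iota eqxx; lia.
have mx : foldr maxn 0 [seq A.1 | A <- s] = size la.
  have le : forall r, (forall A, A \in r -> A.1 <= size la) ->
      foldr maxn 0 [seq A.1 | A : node <- r] <= size la.
    elim=> [//|A r IH] H /=; rewrite geq_max H ?mem_head //=.
    by apply: IH => B hB; apply: H; rewrite inE hB orbT.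
  have ge : forall r (A : node), A \in r -> A.1 <= foldr maxn 0 [seq A.1 | A : node <- r].
    elim=> [//|B r IH] A /=; rewrite inE leq_max => /predU1P[->|/IH ->]; rewrite ?leqnn ?orbT //.
  apply/eqP; rewrite eqn_leq le /=; last first.
    move=> [a b]; rewrite (perm_mem ps) mem_nodes /= => h.
    have [//|lt] := leqP a (size la).
    by move: h; rewrite nth_default; lia.
  have [->//|s0] := posnP (size la).
  apply: (ge s (size la, 1)).
  by rewrite (perm_mem ps) mem_nodes s0 /= part_pos // ltn_predL.
rewrite /row_lengths mx; apply: (@eq_from_nth _ 0); first by rewrite size_map size_iota.
move=> i; rewrite size_map size_iota => hi.
by rewrite (nth_map 0) ?size_iota // nth_iota // cnt // add1n.
Qed.

Lemma is_diagram_part la s : is_part la -> perm_eq s (nodes la) -> is_diagram s.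
Proof. by move=> pl ps; rewrite /is_diagram (row_lengths_nodes pl ps) pl. Qed.

Definition two_col (c1 c2 : nat) : seq nat := nseq c2 2 ++ nseq (c1 - c2) 1.

Lemma nth_two_col c1 c2 i : c2 <= c1 -> nth 0 (two_col c1 c2) i = (i < c1) + (i < c2).
Proof.
move=> h; rewrite nth_cat size_nseq !nth_nseq.
by do ![case: ifP => ?]; lia.
Qed.

Lemma size_two_col c1 c2 : c2 <= c1 -> size (two_col c1 c2) = c1.
Proof. by move=> h; rewrite size_cat !size_nseq; lia. Qed.

Lemma two_col_part c1 c2 : is_part (two_col c1 c2).
Proof.
rewrite /is_part mem_cat !mem_nseq !andbF andbT /two_col.
elim: c2 c1 => [|c2 IH] c1.
  by rewrite subn0 /=; elim: c1 => [|[|c] IHc].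
have -> : c1 - c2.+1 = c1.-1 - c2 by lia.
have {IH} := IH c1.-1; case: c2 => [|c2] //=.
by rewrite subn0; case: (c1.-1) => [|k].
Qed.

Lemma mem_two_col c1 c2 a b : c2 <= c1 -> ((a, b) \in nodes (two_col c1 c2)) =
  (0 < a) && ((b == 1) && (a <= c1) || (b == 2) && (a <= c2)).
Proof. by move=> h; rewrite mem_nodes nth_two_col //; lia. Qed.

Lemma Par2_two_col n la : Par2 n la ->
  exists c1 c2, [/\ c2 <= c1, c1 + c2 = n & la = two_col c1 c2].
Proof.
case/and3P=> /andP[srt n0] /eqP <- {n}; rewrite /two_col.
elim: la srt n0 => [|x la IH] /= srt; first by exists 0, 0.
rewrite inE negb_or => /andP[x0 n0] /andP[x2 al].
have gt : transitive geq by move=> y z w h1 h2; apply: leq_trans h2 h1.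
move: srt; rewrite (path_sortedE gt) => /andP[mx srt].
have [c1 [c2 [h1 h2 E]]] := IH srt n0 al.
have [->|Ex] : x = 2 \/ x = 1 by move: x0; rewrite eq_sym; lia.
  by exists c1.+1, c2.+1; split; [lia|lia|rewrite E subSS].
have c20 : c2 = 0.
  apply/eqP; rewrite -leqn0 leqNgt; apply/negP => h.
  have : 2 \in la by rewrite E mem_cat mem_nseq h.
  by move/(allP mx); rewrite Ex.
exists c1.+1, 0; split; rewrite ?subn0 //=; first by lia.
by rewrite Ex E c20 /= subn0.
Qed.

Lemma perm_add_col1 c1 c2 : c2 <= c1 ->
  perm_eq ((c1.+1, 1) :: nodes (two_col c1 c2)) (nodes (two_col c1.+1 c2)).
Proof.
move=> h; apply: uniq_perm; rewrite ?nodes_uniq //= ?mem_two_col ?nodes_uniq ?andbT //; first lia.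
move=> [a b]; rewrite inE !mem_two_col //; last lia.
by rewrite xpair_eqE; lia.
Qed.

Lemma perm_add_col2 c1 c2 : c2 < c1 ->
  perm_eq ((c2.+1, 2) :: nodes (two_col c1 c2)) (nodes (two_col c1 c2.+1)).
Proof.
move=> h; apply: uniq_perm; rewrite ?nodes_uniq //= ?mem_two_col ?nodes_uniq ?andbT //; try lia.
move=> [a b]; rewrite inE !mem_two_col //; last lia.
by rewrite xpair_eqE; lia.
Qed.

(** The nodes of a partition are closed under going up and left, which leaves
    only these candidates, and adding them gives two-column partitions. Nodes
    in column 3 are excluded, being at most in row [c2]. *)
Lemma addables_below c1 c2 : c2 <= c1 ->
  perm_eq [seq B <- addables (two_col c1 c2) | c2 < B.1]
    ((c1.+1, 1) :: (if c2 < c1 then [:: (c2.+1, 2)] else [::])).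
Proof.
move=> h; apply: uniq_perm.
- apply/filter_uniq/filter_uniq/allpairs_uniq_dep; rewrite ?iota_uniq //.
  by move=> [x y] [x' y'] _ _ /= [-> ->].
- by case: ifP => //= _; rewrite inE xpair_eqE andbF.
move=> [a b]; rewrite mem_filter [X in X && _]/= mem_filter.
have addl : addable (two_col c1 c2) (c1.+1, 1).
  rewrite /addable mem_two_col //; apply/andP; split; first lia.
  exact: is_diagram_part (two_col_part _ _) (perm_add_col1 h).
have addr : c2 < c1 -> addable (two_col c1 c2) (c2.+1, 2).
  move=> lt; rewrite /addable mem_two_col //; apply/andP; split; first lia.
  exact: is_diagram_part (two_col_part _ _) (perm_add_col2 lt).
have hd : head 0 (two_col c1 c2) = (0 < c1) + (0 < c2) by rewrite -nth0 nth_two_col.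
apply/and3P/idP => [[lt ad _]|].
  case/andP: ad => nin /andP[pl pe]; set la := row_lengths _ in pl pe.
  have mem X : (X \in nodes la) = (X == (a, b)) || (X \in nodes (two_col c1 c2)).
    by rewrite -(perm_mem pe) inE.
  have ab : (a, b) \in nodes la by rewrite mem eqxx.
  have := ab; rewrite mem_nodes => /andP[a0 /andP[b0 _]].
  have up1 : 1 < a -> (a.-1, b) \in nodes (two_col c1 c2).
    move=> a1; have := nodes_closed pl ab (a' := a.-1) (b' := b).
    rewrite mem xpair_eqE; have -> : (a.-1 == a) = false by lia.
    by apply; lia.
  have left1 : 1 < b -> (a, b.-1) \in nodes (two_col c1 c2).
    move=> b1; have := nodes_closed pl ab (a' := a) (b' := b.-1).
    rewrite mem xpair_eqE; have -> : (b.-1 == b) = false by lia.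
    by rewrite andbF; apply; lia.
  rewrite !mem_two_col // in nin up1 left1.
  rewrite inE xpair_eqE; case: ifP => lt12; rewrite ?inE ?xpair_eqE; lia.
rewrite inE => /orP[/eqP[-> ->]|].
  split=> //.
  apply/allpairsPdep; exists c1.+1, 1; rewrite !mem_iota size_two_col //; split=> //; lia.
case: ifP => // lt; rewrite inE => /eqP[-> ->]; split=> //; first exact: addr.
apply/allpairsPdep; exists c2.+1, 2; rewrite !mem_iota size_two_col // hd; split=> //; lia.
Qed.

(** A node with another one below it cannot be removed, which leaves the last
    node of the first column. *)
Lemma removables_below c1 c2 : c2 <= c1 ->
  perm_eq [seq B <- removables (two_col c1 c2) | c2 < B.1]
    (if c2 < c1 then [:: (c1, 1)] else [::]).
Proof.
move=> h; apply: uniq_perm.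
- exact/filter_uniq/filter_uniq/nodes_uniq.
- by case: ifP.
move=> [a b]; rewrite !mem_filter /=.
apply/and3P/idP => [[lt rm nin]|].
  case/andP: rm => _ /andP[pl pe]; set la := row_lengths _ in pl pe.
  have mem X : (X \in nodes la) = (X != (a, b)) && (X \in nodes (two_col c1 c2)).
    by rewrite -(perm_mem pe) mem_rem_uniq ?nodes_uniq // inE.
  have nab : (a, b) \notin nodes la by rewrite mem eqxx.
  have down1 : (a.+1, b) \notin nodes (two_col c1 c2).
    apply: contra nab => hin; apply: (@nodes_closed _ a.+1 b) => //; last first.
    - by move: nin; rewrite mem_two_col //; lia.
    - by move: nin; rewrite mem_two_col //; lia.
    by rewrite mem hin xpair_eqE andbT; lia.
  rewrite !mem_two_col // in nin down1.
  by case: ifP => lt12; rewrite ?inE ?xpair_eqE; lia.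
case: ifP => // lt; rewrite inE => /eqP[-> ->].
have pe : perm_eq (nodes (two_col c1 c2)) ((c1, 1) :: nodes (two_col c1.-1 c2)).
  have := @perm_add_col1 c1.-1 c2 ltac:(lia); rewrite prednK; last by lia.
  by rewrite perm_sym.
have hin : (c1, 1) \in nodes (two_col c1 c2) by rewrite mem_two_col //; lia.
split=> //; rewrite /removable hin /=.
apply: (is_diagram_part (two_col_part c1.-1 c2)).
rewrite -(perm_cons (c1, 1)); apply: perm_trans pe.
by rewrite perm_sym perm_to_rem.
Qed.

Lemma natr_Zp_eq0 e x : 1 < e -> (x%:R == 0 :> 'Z_e)%R = (e %| x).
Proof. by move=> e1; rewrite -val_eqE /= val_Zp_nat. Qed.

Lemma node_deg_two_col e c1 c2 A : c2 <= c1 -> c2 <= A.1 ->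
  let eqr := fun B : node => (A.1 < B.1) && (res e B == res e A) in
  node_deg e (two_col c1 c2) A =
  ((count eqr ((c1.+1, 1)%N :: (if (c2 < c1)%N then [:: (c2.+1, 2)%N] else [::])))%:Z -
   (count eqr (if (c2 < c1)%N then [:: (c1, 1)%N] else [::]))%:Z)%R.
Proof.
move=> h hA eqr; rewrite /node_deg -/eqr.
have E s : count eqr s = count eqr [seq B <- s | c2 < B.1].
  rewrite count_filter; apply: eq_count => B /=.
  by rewrite /eqr; case: (ltnP A.1 B.1) => //= lt; rewrite (leq_ltn_trans hA lt) andbT.
rewrite (E (addables _)) (E (removables _)).
by rewrite (permP (addables_below h)) (permP (removables_below h)).
Qed.

Lemma res_succ e a b c : 1 < e -> (res e (a.+1, b) == res e (a, c)) =
  (res e (a, b) - 1 == res e (a, c))%R.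
Proof. by move=> e1; rewrite /res /= -natr1 opprD addrA. Qed.

(** The only node to compare with is the addable one at the foot of column 1,
    whose residue differs by 1. *)
Lemma node_deg_col1 e c1 c2 : 1 < e -> c2 <= c1 ->
  node_deg e (two_col c1 c2) (c1, 1) = 0%R.
Proof.
move=> e1 h; rewrite node_deg_two_col //=.
have -> : res e (c1.+1, 1) == res e (c1, 1) = false.
  by rewrite res_succ // -subr_eq0 addrAC subrr sub0r oppr_eq0 oner_eq0.
rewrite ?andbF; case: ltnP => lt /=; rewrite ?addn0 ?subr0 //.
by rewrite ltnS leqNgt lt ltnn.
Qed.

(** Only the nodes at the foot of column 1 can have the residue of the last
    node of column 2, and they do according to whether the difference of the
    column lengths is next to, or on, a wall. *)
Lemma node_deg_col2 e c1 c2 : 1 < e -> c2 <= c1 ->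
  node_deg e (two_col c1 c2) (c2, 2) =
  ((e %| (c1 - c2).+2)%:Z - (e %| (c1 - c2).+1)%:Z)%R.
Proof.
move=> e1 h; rewrite node_deg_two_col //=.
have E1 : (res e (c1.+1, 1) == res e (c2, 2)) = (e %| (c1 - c2).+2).
  have N : (((c1 - c2).+2)%:R = c1%:R - c2%:R + 2%:R :> 'Z_e)%R.
    by rewrite -[(c1 - c2).+2]addn2 natrD natrB.
  rewrite -natr_Zp_eq0 // N /res /= eq_sym -subr_eq0; congr (_ == _).
  by rewrite -natr1; ring.
have E2 : (res e (c2.+1, 2) == res e (c2, 2)) = false.
  by rewrite res_succ // -subr_eq0 addrAC subrr sub0r oppr_eq0 oner_eq0.
have E3 : (res e (c1, 1) == res e (c2, 2)) = (e %| (c1 - c2).+1).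
  have N : (((c1 - c2).+1)%:R = c1%:R - c2%:R + 1 :> 'Z_e)%R.
    by rewrite -natr1 natrB.
  rewrite -natr_Zp_eq0 // N /res /= eq_sym -subr_eq0; congr (_ == _).
  by ring.
rewrite E1 ltnS h /=; case: ltnP => lt /=; first by rewrite E2 E3 lt andbF !addn0.
have -> : c1 = c2 by lia.
by rewrite subnn dvdn1 addn0; case: eqP => // E; rewrite E in e1.
Qed.

(** * Two-column standard tableaux as paths *)

Definition precedes (A B : node) : bool :=
  ((A.1 == B.1) && (A.2 < B.2)) || ((A.2 == B.2) && (A.1 < B.1)).

Lemma standardP (t : tableau) :
  reflect {in t &, forall A B, precedes A B -> index A t < index B t} (standard t).
Proof.
apply: (iffP allP) => [H A B hA hB|H A hA].
  by move/allP: (H A hA) => /(_ B hB) /implyP.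
by apply/allP => B hB; apply/implyP; apply: H.
Qed.

(** A last entry is larger than all others, so it only must not precede any of
    them. *)
Lemma standard_rcons (t : tableau) (A : node) : A \notin t ->
  standard (rcons t A) = standard t && all (fun B => ~~ precedes A B) t.
Proof.
move=> nA.
have i1 B : B \in t -> index B (rcons t A) = index B t.
  by move=> hB; rewrite -cats1 index_cat hB.
have i2 : index A (rcons t A) = size t.
  by rewrite -cats1 index_cat (negbTE nA) /= eqxx addn0.
have irr : precedes A A = false by rewrite /precedes !ltnn !andbF.
apply/standardP/andP => [H|[/standardP H /allP H'] B C].
  split.
    apply/standardP => B C hB hC hBC; rewrite -!i1 //.
    by apply: H; rewrite ?mem_rcons ?inE ?hB ?hC ?orbT.
  apply/allP => B hB; apply/negP => hAB.
  have := H A B _ _ hAB; rewrite !mem_rcons mem_head inE hB orbT => /(_ isT isT).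
  by rewrite i2 (i1 B hB) ltnNge ltnW // index_mem.
rewrite !mem_rcons !inE => /predU1P[->|hB] /predU1P[->|hC].
- by rewrite irr.
- by move: (H' C hC) => /negbTE ->.
- by rewrite (i1 B hB) i2 index_mem.
- by rewrite !i1 //; apply: H.
Qed.

(** Standard tableaux with columns of lengths [c1] and [c2], built by adding
    the nodes in the order of their entries. The path, the degree and the
    residues grow by one step at a time with such a tableau. *)
Inductive std2 : nat -> nat -> tableau -> Prop :=
| Std2_nil : std2 0 0 [::]
| Std2_col1 c1 c2 t : c2 <= c1 -> std2 c1 c2 t -> std2 c1.+1 c2 (rcons t (c1.+1, 1))
| Std2_col2 c1 c2 t : c2 < c1 -> std2 c1 c2 t -> std2 c1 c2.+1 (rcons t (c2.+1, 2)).

Lemma std2_le c1 c2 t : std2 c1 c2 t -> c2 <= c1.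
Proof. by case=> // *; lia. Qed.

Lemma perm_rcons_cons (T : eqType) (s r : seq T) x :
  perm_eq (rcons s x) (x :: r) = perm_eq s r.
Proof. by rewrite perm_rcons perm_cons. Qed.

Lemma std2_perm c1 c2 t : std2 c1 c2 t ->
  perm_eq t (nodes (two_col c1 c2)) && standard t.
Proof.
elim=> {c1 c2 t} [//|c1 c2 t h _ /andP[pe st]|c1 c2 t h _ /andP[pe st]].
  apply/andP; split.
    apply: perm_trans (perm_add_col1 h); by rewrite perm_rcons_cons.
  rewrite standard_rcons ?st; last by rewrite (perm_mem pe) mem_two_col //; lia.
  apply/allP => [[a b]]; rewrite (perm_mem pe) mem_two_col // /precedes /=; lia.
apply/andP; split.
  apply: perm_trans (perm_add_col2 h); by rewrite perm_rcons_cons.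
rewrite standard_rcons ?st; last by rewrite (perm_mem pe) mem_two_col //; lia.
apply/allP => [[a b]]; rewrite (perm_mem pe) mem_two_col /precedes /=; lia.
Qed.

(** The largest entry is at the bottom of its column; if this is column 1, then
    it has no right neighbour, so that column 1 is strictly longer. *)
Lemma perm_std2 c1 c2 t : c2 <= c1 -> perm_eq t (nodes (two_col c1 c2)) -> standard t ->
  std2 c1 c2 t.
Proof.
elim/last_ind: t c1 c2 => [|t A IH] c1 c2 h pe st.
  have z a b : (a, b) \notin nodes (two_col c1 c2) by rewrite -(perm_mem pe).
  have := z c1 1; have := z c2 2; rewrite !mem_two_col // => h1 h2.
  have -> : c1 = 0 by lia.
  have -> : c2 = 0 by lia.
  exact: Std2_nil.
have u : uniq (rcons t A) by rewrite (perm_uniq pe) nodes_uniq.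
have nA : A \notin t by move: u; rewrite rcons_uniq => /andP[].
move: st; rewrite standard_rcons // => /andP[st /allP mx].
have hA : A \in nodes (two_col c1 c2) by rewrite -(perm_mem pe) mem_rcons mem_head.
have mt B : B != A -> B \in nodes (two_col c1 c2) -> B \in t.
  by move=> ne; rewrite -(perm_mem pe) mem_rcons inE (negbTE ne).
case: A nA hA pe mx mt {u} => a b nA hA pe mx mt.
move: (hA); rewrite mem_two_col // => /andP[a0 /orP[/andP[/eqP b1 ac]|/andP[/eqP b2 ac]]].
- subst b.
  have Ea : a = c1.
    apply/eqP; rewrite eqn_leq ac leqNgt; apply/negP => lt.
    have hB : (c1, 1) \in t.
      by apply: mt; rewrite ?xpair_eqE ?mem_two_col //; lia.
    by have := mx _ hB; rewrite /precedes /= lt orbT.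
  subst a.
  have lt : c2 < c1.
    rewrite ltnNge; apply/negP => ge.
    have hB : (c1, 2) \in t.
      by apply: mt; rewrite ?xpair_eqE ?mem_two_col //; lia.
    by have := mx _ hB; rewrite /precedes /= eqxx.
  case: c1 a0 lt h nA hA pe mx mt ac => // c1 _ lt h nA hA pe mx mt _.
  apply: Std2_col1 => //; apply: IH => //.
  rewrite -(perm_rcons_cons _ _ (c1.+1, 1)); apply: perm_trans pe _.
  by rewrite perm_sym perm_add_col1.
subst b.
have Ea : a = c2.
  apply/eqP; rewrite eqn_leq ac leqNgt; apply/negP => lt.
  have hB : (c2, 2) \in t.
    by apply: mt; rewrite ?xpair_eqE ?mem_two_col //; lia.
  by have := mx _ hB; rewrite /precedes /= lt orbT.
subst a; case: c2 a0 h nA hA pe mx mt ac => // c2 _ h nA hA pe mx mt _.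
apply: Std2_col2 => //; apply: IH => //; first exact: ltnW.
rewrite -(perm_rcons_cons _ _ (c2.+1, 2)); apply: perm_trans pe _.
by rewrite perm_sym perm_add_col2.
Qed.

Lemma mem_Std_two_col c1 c2 t : c2 <= c1 -> t \in Std (two_col c1 c2) <-> std2 c1 c2 t.
Proof.
move=> h; rewrite mem_Std; split; first by case/andP; apply: perm_std2.
exact: std2_perm.
Qed.

Lemma std2_size c1 c2 t : std2 c1 c2 t -> size t = c1 + c2.
Proof. by elim=> // *; rewrite size_rcons; lia. Qed.

Lemma std2_count c1 c2 t : std2 c1 c2 t ->
  count (fun A : node => A.2 == 1) t = c1 /\ count (fun A : node => A.2 == 2) t = c2.
Proof.
by elim=> // {}c1 {}c2 {}t _ _ [E1 E2]; rewrite -!cats1 !count_cat E1 E2 /= ?addn0 ?addn1.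
Qed.

Lemma path_of_rcons t A : path_of (rcons t A) =
  rcons (path_of t) (count (fun A : node => A.2 == 1) (rcons t A) -
                     count (fun A : node => A.2 == 2) (rcons t A)).
Proof.
rewrite {1}/path_of size_rcons mkseqS take_oversize ?size_rcons //.
congr rcons; apply/eq_in_map => a; rewrite mem_iota add0n ltnS => /andP[_ ha].
by rewrite -cats1 takel_cat.
Qed.

Lemma is_path_rcons n pi v : is_path n pi ->
  v = (nth 0 pi n).+1 \/ nth 0 pi n = v.+1 -> is_path n.+1 (rcons pi v).
Proof.
move=> [sz z0 st] hv; split; rewrite ?size_rcons ?sz //; first by rewrite nth_rcons sz.
move=> c; rewrite ltnS leq_eqVlt => /predU1P[->|lt].
  by rewrite !nth_rcons sz ltnSn ltnn eqxx.
by rewrite !nth_rcons sz !ltnS lt (ltnW lt); apply: st.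
Qed.

Lemma path_of_col1 c1 c2 t : c2 <= c1 -> std2 c1 c2 t ->
  path_of (rcons t (c1.+1, 1)) = rcons (path_of t) (c1.+1 - c2).
Proof.
by move=> h s; rewrite path_of_rcons; have [-> ->] := std2_count (Std2_col1 h s).
Qed.

Lemma path_of_col2 c1 c2 t : c2 < c1 -> std2 c1 c2 t ->
  path_of (rcons t (c2.+1, 2)) = rcons (path_of t) (c1 - c2.+1).
Proof.
by move=> h s; rewrite path_of_rcons; have [-> ->] := std2_count (Std2_col2 h s).
Qed.

Lemma std2_path c1 c2 t : std2 c1 c2 t ->
  is_path (size t) (path_of t) /\ nth 0 (path_of t) (size t) = c1 - c2.
Proof.
elim=> {c1 c2 t} [//|c1 c2 t h s [P E]|c1 c2 t h s [P E]]; have [sz _ _] := P.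
  rewrite (path_of_col1 h s) size_rcons nth_rcons sz ltnn eqxx; split=> //.
  by apply: is_path_rcons => //; rewrite E; lia.
rewrite (path_of_col2 h s) size_rcons nth_rcons sz ltnn eqxx; split=> //.
by apply: is_path_rcons => //; rewrite E; lia.
Qed.

Lemma count_iotaS (a : pred nat) c : count a (iota 0 c.+1) = count a (iota 0 c) + a c.
Proof. by rewrite -[c.+1]addn1 iotaD count_cat /= addn0. Qed.

Lemma count_up n pi c : is_path n pi -> c <= n ->
  2 * count (up pi) (iota 0 c) = c + nth 0 pi c /\
  2 * count (predC (up pi)) (iota 0 c) + nth 0 pi c = c.
Proof.
move=> [_ z0 st]; elim: c => [|c IH] hc; first by rewrite z0.
have [a b] := IH (ltnW hc); rewrite !count_iotaS /=.
have -> : up pi c = (nth 0 pi c < nth 0 pi c.+1) by [].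
by have := st c hc; case: ltnP => /= *; lia.
Qed.

Lemma tab_ofE n pi : size pi = n.+1 -> tab_of pi =
  mkseq (fun r => if up pi r then (count (up pi) (iota 0 r.+1), 1)
                  else (count (predC (up pi)) (iota 0 r.+1), 2)) n.
Proof. by move=> sz; rewrite /tab_of sz. Qed.

Lemma tab_of_rcons n pi v : is_path n pi -> tab_of (rcons pi v) =
  rcons (tab_of pi) (if nth 0 pi n < v then ((count (up pi) (iota 0 n)).+1, 1)
                     else ((count (predC (up pi)) (iota 0 n)).+1, 2)).
Proof.
move=> [sz _ _]; rewrite (tab_ofE (n := n.+1)) ?size_rcons ?sz // (tab_ofE sz).
have U c : c < n -> up (rcons pi v) c = up pi c.
  by move=> h; rewrite /up !nth_rcons sz !ltnS h (ltnW h).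
have Un : up (rcons pi v) n = (nth 0 pi n < v).
  by rewrite /up !nth_rcons sz ltnSn ltnn eqxx.
have C (a b : pred nat) m : m <= n -> (forall c, c < n -> a c = b c) ->
    count a (iota 0 m) = count b (iota 0 m).
  move=> hm H; apply: eq_in_count => c; rewrite mem_iota => hc; apply: H; lia.
have U' c : c < n -> predC (up (rcons pi v)) c = predC (up pi) c by move=> /U /= ->.
rewrite mkseqS; congr rcons.
  apply/eq_in_map => c; rewrite mem_iota add0n => /andP[_ hc].
  by rewrite U // (C _ _ _ hc U) (C _ _ _ hc U').
by rewrite !count_iotaS (C _ _ _ (leqnn n) U) (C _ _ _ (leqnn n) U') /= Un; case: ltnP;
  rewrite addn1.
Qed.

(** Paths are analysed from their last step, since [tab_of] and [path_of]
    commute with appending one. *)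
Lemma path_rconsP n pi : is_path n.+1 pi -> exists2 pi', is_path n pi' &
  exists2 v, pi = rcons pi' v & v = (nth 0 pi' n).+1 \/ nth 0 pi' n = v.+1.
Proof.
case: (lastP pi) => [[]//|pi' v] [sz z0 st]; rewrite size_rcons in sz.
case: sz => sz; have N c : c <= n -> nth 0 (rcons pi' v) c = nth 0 pi' c.
  by move=> h; rewrite nth_rcons sz ltnS h.
exists pi'; first split=> //; first by rewrite -N.
  by move=> c hc; have := st c (leqW hc); rewrite !N // ltnW.
exists v => //; have := st n (ltnSn n).
by rewrite (N n (leqnn n)) !nth_rcons sz ltnn eqxx.
Qed.

Lemma tab_of_std2 n pi c1 c2 : is_path n pi -> c2 <= c1 -> c1 + c2 = n ->
  nth 0 pi n = c1 - c2 -> std2 c1 c2 (tab_of pi).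
Proof.
elim: n pi c1 c2 => [|n IH] pi c1 c2 P h s E.
  have -> : c1 = 0 by lia.
  have -> : c2 = 0 by lia.
  by case: P => sz _ _; rewrite /tab_of sz; apply: Std2_nil.
have [pi' P' [v Epi hv]] := path_rconsP P.
have [u d] := count_up P' (leqnn n).
subst pi; rewrite (tab_of_rcons v P').
have [sz _ _] := P'.
rewrite nth_rcons sz ltnn eqxx in E.
case: hv => hv.
  have -> : nth 0 pi' n < v by lia.
  case: c1 h s E => [|c1] h s E; first by lia.
  have -> : count (up pi') (iota 0 n) = c1 by lia.
  by apply: Std2_col1; [|apply: IH => //]; lia.
have -> : (nth 0 pi' n < v) = false by lia.
case: c2 h s E => [|c2] h s E; first by lia.
have -> : count (predC (up pi')) (iota 0 n) = c2 by lia.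
by apply: Std2_col2; [|apply: IH => //]; lia.
Qed.

Lemma tab_ofK n pi : is_path n pi -> path_of (tab_of pi) = pi.
Proof.
elim: n pi => [|n IH] pi P.
  by case: P => [sz z0 _]; case: pi sz z0 => [|x [|y s]] //= _ ->.
have [pi' P' [v Epi hv]] := path_rconsP P.
have [u d] := count_up P' (leqnn n).
have le := path_height P' (leqnn n).
(* the halves are the column lengths of the tableau of [pi'] *)
have := @tab_of_std2 n pi' ((n + nth 0 pi' n)./2) ((n - nth 0 pi' n)./2) P'.
have par := path_parity P' (leqnn n).
move=> /(_ ltac:(lia) ltac:(lia) ltac:(lia)) /std2_count [n1 n2].
rewrite Epi (tab_of_rcons v P') path_of_rcons IH //; congr rcons.
by rewrite -cats1 !count_cat n1 n2; case: ltnP => hlt /=; lia.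
Qed.

Lemma path_ofK c1 c2 t : std2 c1 c2 t -> tab_of (path_of t) = t.
Proof.
elim=> {c1 c2 t} [//|c1 c2 t h s IH|c1 c2 t h s IH]; have [P E] := std2_path s;
  have [u d] := count_up P (leqnn _); have sz := std2_size s.
  rewrite (path_of_col1 h s) (tab_of_rcons _ P) IH E; congr rcons.
  have -> : c1 - c2 < c1.+1 - c2 by lia.
  by have -> : count (up (path_of t)) (iota 0 (size t)) = c1 by lia.
rewrite (path_of_col2 h s) (tab_of_rcons _ P) IH E; congr rcons.
have -> : (c1 - c2 < c1 - c2.+1) = false by lia.
by have -> : count (predC (up (path_of t))) (iota 0 (size t)) = c2 by lia.
Qed.

Lemma up_rcons n pi v c : is_path n pi -> c < n -> up (rcons pi v) c = up pi c.
Proof. by move=> [sz _ _] h; rewrite /up !nth_rcons sz !ltnS h (ltnW h). Qed.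

(** The last node of a tableau contributes the contribution of the last step of
    its path, because the difference of the column lengths is the height after
    this step. *)
Lemma std2_deg e c1 c2 t : 1 < e -> std2 c1 c2 t ->
  deg e t = path_deg e (path_of t) 0 (size t).
Proof.
move=> e1.
have D (s : tableau) A m : m <= size s -> deg_upto e (rcons s A) m = deg_upto e s m.
  elim: m => [//|m IH] hm /=; rewrite IH ?(ltnW hm) // nth_rcons hm.
  by rewrite -cats1 takel_cat.
have step (s : tableau) A : deg e (rcons s A) = (node_deg e (row_lengths (rcons s A)) A + deg e s)%R.
  by rewrite /deg size_rcons /= D // take_oversize ?size_rcons // nth_rcons ltnn eqxx.
have pstep n pi v : is_path n pi -> path_deg e (rcons pi v) 0 n.+1 =
    (path_deg e pi 0 n + step_deg e (rcons pi v) n)%R.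
  move=> P; rewrite path_degS //; congr (_ + _)%R; rewrite /path_deg !big_nat.
  apply: eq_bigr => c /andP[_ hc]; rewrite /step_deg (up_rcons v P hc).
  by case: P => sz _ _; rewrite !nth_rcons sz !ltnS hc (ltnW hc).
elim=> {c1 c2 t} [|c1 c2 t h s IH|c1 c2 t h s IH]; first by rewrite /path_deg big_geq.
  have [P E] := std2_path s; have [sz _ _] := P;
  have pe := std2_perm (Std2_col1 h s).
  rewrite step (row_lengths_nodes (two_col_part c1.+1 c2)); last by case/andP: pe.
  rewrite node_deg_col1 //; last exact: leqW.
  rewrite size_rcons (path_of_col1 h s) (pstep _ _ _ P) IH add0r.
  rewrite /step_deg /up !nth_rcons sz ltnSn ltnn eqxx E.
  have -> : c1 - c2 < c1.+1 - c2 by lia.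
  by rewrite addr0.
have [P E] := std2_path s; have [sz _ _] := P;
have pe := std2_perm (Std2_col2 h s).
rewrite step (row_lengths_nodes (two_col_part c1 c2.+1)); last by case/andP: pe.
rewrite node_deg_col2 // size_rcons (path_of_col2 h s) (pstep _ _ _ P) IH addrC; congr (_ + _)%R.
rewrite /step_deg /up !nth_rcons sz ltnSn ltnn eqxx E.
have -> : (c1 - c2 < c1 - c2.+1) = false by lia.
by have -> : (c1 - c2.+1).+2 = (c1 - c2).+1 by lia.
Qed.

Lemma std2_res e c1 c2 t : std2 c1 c2 t ->
  res_seq e t = mkseq (path_res e (path_of t)) (size t).
Proof.
have pstep n pi v : is_path n pi -> mkseq (path_res e (rcons pi v)) n.+1 =
    rcons (mkseq (path_res e pi) n) (path_res e (rcons pi v) n).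
  move=> P; rewrite mkseqS; congr rcons; apply/eq_in_map => c.
  rewrite mem_iota => hc; rewrite /path_res (up_rcons v P); last by lia.
  by case: P => sz _ _; rewrite !nth_rcons sz ltnW.
elim=> {c1 c2 t} [//|c1 c2 t h s IH|c1 c2 t h s IH];
  have [P E] := std2_path s; have [sz _ _] := P; have st := std2_size s.
  rewrite size_rcons (path_of_col1 h s) (pstep _ _ _ P) /res_seq map_rcons -/(res_seq e t) IH.
  congr rcons; rewrite /path_res /up !nth_rcons sz ltnSn ltnn eqxx E.
  have -> : c1 - c2 < c1.+1 - c2 by lia.
  have -> : (size t + (c1 - c2))./2 = c1 by have := std2_le s; lia.
  by rewrite /res /= -natr1; ring.
rewrite size_rcons (path_of_col2 h s) (pstep _ _ _ P) /res_seq map_rcons -/(res_seq e t) IH.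
congr rcons; rewrite /path_res /up !nth_rcons sz ltnSn ltnn eqxx E.
have -> : (c1 - c2 < c1 - c2.+1) = false by lia.
have -> : (size t - (c1 - c2))./2 = c2 by lia.
by rewrite /res /= -natr1; ring.
Qed.

(** * The case p > 1 *)

Lemma Std_path c1 c2 t : c2 <= c1 -> t \in Std (two_col c1 c2) ->
  [/\ is_path (c1 + c2) (path_of t), last 0 (path_of t) = c1 - c2,
      tab_of (path_of t) = t & size t = c1 + c2].
Proof.
move=> h /(mem_Std_two_col t h) s; have [P E] := std2_path s; have sz := std2_size s.
rewrite -sz; split=> //; last exact: path_ofK s.
by rewrite (path_last P).
Qed.

Lemma tab_of_Std c1 c2 pi : c2 <= c1 -> is_path (c1 + c2) pi ->
  (tab_of pi \in Std (two_col c1 c2)) = (last 0 pi == c1 - c2).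
Proof.
move=> h P; apply/idP/eqP => [/(Std_path h)[_ <- _ _]|]; first by rewrite (tab_ofK P).
by rewrite (path_last P) => E; apply/mem_Std_two_col => //; apply: (tab_of_std2 P).
Qed.

Section Positive.

Variables (e p c1 c2 d1 d2 : nat).
Hypotheses (e1 : 1 < e) (p1 : 1 < p).
Hypotheses (hc : c2 <= c1) (hd : d2 <= d1) (hcd : c1 + c2 = d1 + d2).
Local Notation n := (d1 + d2).
Local Notation la := (two_col c1 c2).
Local Notation mu := (two_col d1 d2).

(** Membership in the domain, translated into a run of the recursion on paths
    with prescribed ends. *)
Lemma Std_reg_chain t : t \in Std_reg e p mu la -> exists Z eta,
  [/\ is_path n (path_of t), last 0 (path_of t) = c1 - c2, regchain e p Z (path_of t) eta,
      reg' e p t = tab_of (rho e p Z eta) & last 0 eta = d1 - d2].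
Proof.
rewrite mem_filter => /andP[hr /(Std_path hc)]; rewrite hcd => -[P L K _].
exists (reg_set e p (path_of t)), (reg_ep e p (path_of t)).
have ch := chain_reg e1 p1 P; have [Pe _ _] := chain_inv e1 p1 ch P.
move: hr; rewrite /reg' /regT (tab_of_Std hd Pe) => /eqP Le.
by split=> //; rewrite (tab_ofK Pe).
Qed.

Lemma chain_Std_reg Z pi eta : is_path n pi -> last 0 pi = c1 - c2 ->
  regchain e p Z pi eta -> last 0 eta = d1 - d2 ->
  tab_of pi \in Std_reg e p mu la /\ reg' e p (tab_of pi) = tab_of (rho e p Z eta).
Proof.
move=> P L ch Le; have [Pe _ _] := chain_inv e1 p1 ch P.
have [EZ Ee] := chain_regE e1 p1 P ch.
rewrite mem_filter /reg' /regT (tab_ofK P) EZ Ee (tab_ofK Pe).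
by rewrite !tab_of_Std ?L ?Le ?eqxx // hcd.
Qed.

Lemma DStd_path s : s \in DStd e p mu ->
  [/\ is_path n (path_of s), last 0 (path_of s) = d1 - d2,
      tab_of (path_of s) = s & regular e p (path_of s)].
Proof.
rewrite mem_filter => /andP[/eqP hr /(Std_path hd)[P L K _]]; split=> //.
apply/(reg_ep_regular e1 p1 P); rewrite /regT in hr.
have [Pe _ _] := chain_inv e1 p1 (chain_reg e1 p1 P) P.
by rewrite -{2}hr (tab_ofK Pe).
Qed.

Lemma path_DStd pi : is_path n pi -> last 0 pi = d1 - d2 -> regular e p pi ->
  tab_of pi \in DStd e p mu.
Proof.
move=> P L R; rewrite mem_filter (tab_of_Std hd P) L eqxx andbT /regT (tab_ofK P).
by have /(reg_ep_regular e1 p1 P) -> := R.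
Qed.

Lemma reg'_DStd t : t \in Std_reg e p mu la -> reg' e p t \in DStd e p mu.
Proof.
move=> /Std_reg_chain[Z [eta [P L ch -> Le]]].
have [Pe Re _] := chain_inv e1 p1 ch P.
apply: path_DStd; first exact: (rho_path e1 p1 Pe Z).
  by rewrite (last_rho e1 p1 Pe).
exact: (rho_regular e1 p1 Pe Z Re).
Qed.

(** Both sets are admissible for the common end of the regular paths, and give
    the same end for the given ones. *)
Lemma reg_set_const Z Z' pi pi' eta eta' : is_path n pi -> is_path n pi' ->
  last 0 pi = last 0 pi' -> last 0 eta = last 0 eta' ->
  regchain e p Z pi eta -> regchain e p Z' pi' eta' -> Z = Z'.
Proof.
move=> P P' E Ee ch ch'.
have := chain_end e1 p1 ch P; rewrite E (chain_end e1 p1 ch' P') Ee => /esym.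
by apply: (source_end_inj e1 p1); [rewrite -Ee; apply: chain_admissible ch P |
  apply: chain_admissible ch' P'].
Qed.

(** The set [Z] is the same for both tableaux, so first [rho_Z] and then the
    mirrorings are undone. *)
Lemma reg'_inj t u : t \in Std_reg e p mu la -> u \in Std_reg e p mu la ->
  reg' e p t = reg' e p u -> t = u.
Proof.
move=> ht hu.
have [Z [eta [P L ch -> Le]]] := Std_reg_chain ht.
have [Z' [eta' [P' L' ch' -> Le']]] := Std_reg_chain hu.
have EZ : Z = Z' by apply: reg_set_const ch ch'; rewrite ?L ?Le.
subst Z'; have [Pe _ _] := chain_inv e1 p1 ch P.
have [Pe' _ _] := chain_inv e1 p1 ch' P'; have sZ := chain_sorted e1 p1 ch P.
move/(congr1 path_of); rewrite (tab_ofK (rho_path e1 p1 Pe Z)) (tab_ofK (rho_path e1 p1 Pe' Z)).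
move/(congr1 (rho e p Z)); rewrite (rho_invol e1 p1 sZ Pe) (rho_invol e1 p1 sZ Pe') => Ee; subst eta'.
have E := chain_inj e1 p1 P P' ch ch'.
have K v : v \in Std_reg e p mu la -> tab_of (path_of v) = v.
  by rewrite mem_filter => /andP[_ /(Std_path hc)[]].
by rewrite -(K t ht) E K.
Qed.

(** The set [Z] is supplied by any tableau [t0] in the domain. Apply [rho_Z],
    then undo the mirrorings. *)
Lemma reg'_surj t0 s : t0 \in Std_reg e p mu la -> s \in DStd e p mu ->
  exists2 t, t \in Std_reg e p mu la & reg' e p t = s.
Proof.
move=> /Std_reg_chain[Z [eta0 [P0 L0 ch0 _ Le0]]] /DStd_path[P L K R].
have sZ := chain_sorted e1 p1 ch0 P0.
have Pe := rho_path e1 p1 P Z; have Re := rho_regular e1 p1 P Z R.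
have Le : last 0 (rho e p Z (path_of s)) = d1 - d2 by rewrite (last_rho e1 p1 P).
have := chain_admissible e1 p1 ch0 P0; rewrite Le0 -Le => ad.
have [pi Pp ch] := chain_exists e1 p1 Pe Re ad.
have Lp : last 0 pi = c1 - c2.
  apply: succn_inj; rewrite (chain_end e1 p1 ch Pp) -L0 (chain_end e1 p1 ch0 P0).
  by rewrite Le Le0.
have [h1 h2] := chain_Std_reg Pp Lp ch Le.
by exists (tab_of pi); rewrite // h2 (rho_invol e1 p1 sZ P).
Qed.

Lemma reg'_res_deg t : t \in Std_reg e p mu la ->
  res_seq e (reg' e p t) = res_seq e t /\
  deg e t = (deg e (reg' e p t) + (r_tab e t)%:Z)%R.
Proof.
move=> ht; have := reg'_DStd ht; rewrite mem_filter => /andP[_ hs'].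
have st' := hs'; have [_ _ _ sz'] := Std_path hd st'.
have [Z [eta [P L ch E Le]]] := Std_reg_chain ht.
have [Pe Re _] := chain_inv e1 p1 ch P; have Pz := rho_path e1 p1 Pe Z.
move: ht; rewrite mem_filter => /andP[_ ht]; have [_ _ _ sz] := Std_path hc ht.
move/(mem_Std_two_col _ hc): ht => s; move/(mem_Std_two_col _ hd): hs' => s'.
rewrite (std2_res e s) (std2_res e s') (std2_deg e1 s) (std2_deg e1 s').
rewrite sz sz' hcd E (tab_ofK Pz); split.
  apply/eq_in_map => c; rewrite mem_iota add0n => /andP[_ cn].
  by rewrite (rho_res e1 p1 Z Pe cn) (chain_res e1 p1 ch P cn).
exact: (rho_deg e1 p1 ch P).
Qed.

Lemma r_tab_const t t0 : t \in Std_reg e p mu la -> t0 \in Std_reg e p mu la ->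
  r_tab e t = r_tab e t0.
Proof.
move=> /Std_reg_chain[Z [eta [P L ch _ Le]]] /Std_reg_chain[Z0 [eta0 [P0 L0 ch0 _ Le0]]].
have EZ : Z = Z0 by apply: reg_set_const ch ch0; rewrite ?L ?Le.
by rewrite /r_tab (chain_r_path e1 p1 ch P) (chain_r_path e1 p1 ch0 P0) Le Le0 EZ.
Qed.

Lemma q_neq0 : q != 0%R.
Proof. by rewrite /q tofrac_eq0 polyX_eq0. Qed.

(** Reindex the sum along the bijection; each term has the same residue
    sequence, and its degree is shifted by the constant [r]. *)
Lemma ch_reg' m t0 : t0 \in Std_reg e p mu la ->
  ch e m (Std_reg e p mu la) = ((q ^+ r_tab e t0) *: ch e m (DStd e p mu))%R.
Proof.
move=> h0.
have perm : perm_eq (DStd e p mu) [seq reg' e p t | t <- Std_reg e p mu la].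
  apply: uniq_perm; first exact/filter_uniq/Std_uniq.
    rewrite map_inj_in_uniq; first exact/filter_uniq/Std_uniq.
    by move=> t u; apply: reg'_inj.
  move=> s; apply/idP/mapP => [/(reg'_surj h0)[t ht <-]|[t ht ->]]; first by exists t.
  exact: reg'_DStd.
rewrite /ch (perm_big _ perm) big_map scaler_sumr big_seq [RHS]big_seq.
apply: eq_bigr => t ht; have [-> ->] := reg'_res_deg ht.
rewrite (r_tab_const ht h0) scalerA; congr (_ *: _)%R.
by rewrite expfzDr ?q_neq0 // mulrC.
Qed.

End Positive.

(** * The case p = 0 *)

Section Zero.

Variables (e n : nat).
Hypothesis e1 : 1 < e.
Local Notation p := n.+2.
Let p1 : 1 < p := isT.

(** A wall of positive level is too high to be reached in [n] steps when [p = n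
    + 2]. *)
Lemma reg_level0 z pi : is_path n pi -> reg (gap e p z) pi <> pi -> z = 0.
Proof.
move=> P ne; have [/andP[w0 wn] dw _] := below_down (gap_gt1 e1 p1 z) P ne.
have := dvdn_leq (ltn0Sn _) dw; have := path_height P (ltnW wn).
case: z {ne w0 wn dw} => // z; set w := nth 0 pi _ => h1 h2.
have : n.+2 <= gap e p z.+1.
  rewrite /gap expnS mulnCA; apply: leq_pmulr.
  by rewrite muln_gt0 expn_gt0 /= andbT; lia.
have := lastwall_le (gap e p z.+1) P; lia.
Qed.

Lemma chain_char0 Z pi eta : is_path n pi -> regchain e p Z pi eta ->
  {in Z, forall z, z = 0} /\ reg e pi = eta.
Proof.
move=> P ch; have [EZ Ee] := chain_regE e1 p1 P ch.
have sZ := chain_sorted e1 p1 ch P.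
case: ch P sZ {EZ Ee} => [{}pi R P _|z {}Z {}pi {}eta ne fx ch P sZ].
  by split=> //; have := R 0; rewrite gap0.
have z0 := reg_level0 P ne; subst z.
case: Z ch sZ => [|z' Z] ch sZ; last by case/andP: sZ.
split; first by move=> z; rewrite inE => /eqP.
have [_ Ee] := chain_regE e1 p1 (reg_path (gap_gt1 e1 p1 0) P) ch.
by inversion ch; rewrite gap0.
Qed.

(** Only level 0 occurs, and its last wall comes after all the arcs, so no arc
    was mirrored. *)
Lemma rho_char0 Z eta : sorted gtn Z -> is_path n eta -> {in Z, forall z, z = 0} ->
  rho e p Z eta = eta.
Proof.
move=> sZ P Z0.
apply: (path_ext P); first by rewrite size_rho; case: P.
move=> c hc; case: (arcP e eta c) => [k hk hck|H|sB h].
- have hc' : nth 0 (walls e eta) k <= c <= nth 0 (walls e eta) k.+1 by lia.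
  rewrite (rho_arc e1 p1 P Z hk hc') reflected_arcE //.
  suff -> : mirrored e p Z eta (nth 0 (walls e eta) k) = false by rewrite andbF.
  rewrite /mirrored; suff -> : count (fun z => lastwall (gap e p z) eta <=
      nth 0 (walls e eta) k) Z = 0 by [].
  apply/eqP; rewrite -leqn0 leqNgt -has_count; apply/hasPn => z /Z0 ->.
  rewrite gap0 -ltnNge; have := wall_le_last hk; have := wall_lt hk (ltnSn k); lia.
- by rewrite (rho_before e1 p1 P).
- by rewrite (rho_after e1 p1 P) // h.
Qed.

Lemma reg_ep_char0 pi : is_path n pi -> reg_ep e 0 pi = reg_ep e p pi.
Proof.
by move=> P; have [_ <-] := chain_char0 P (chain_reg e1 p1 P).
Qed.

Lemma reg'_char0 t : is_path n (path_of t) -> reg' e 0 t = reg' e p t.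
Proof.
move=> P; have ch := chain_reg e1 p1 P.
have [Z0 _] := chain_char0 P ch; have [Pe _ _] := chain_inv e1 p1 ch P.
have E0 : reg' e 0 t = tab_of (path_of (tab_of (reg_ep e 0 (path_of t)))) by [].
rewrite {}E0 (reg_ep_char0 P) /reg' /regT (tab_ofK Pe).
by rewrite (rho_char0 (chain_sorted e1 p1 ch P) Pe Z0).
Qed.

End Zero.

(** * The bijection and the graded characters *)

Theorem theorem4p22 (e n p : nat) (la mu : seq nat)
    (he : 2 <= e)
    (hp : p = 0 \/ (prime p /\ (p = e \/ coprime p e)))
    (hla : Par2 n la)
    (hmu : RPar2 e n mu)
    (hne : exists t : tableau, t \in Std_reg e p mu la) :
  [/\ (* (i) *)
      [/\ forall t : tableau, t \in Std_reg e p mu la ->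
            reg' e p t \in DStd e p mu,
          forall t u : tableau, t \in Std_reg e p mu la ->
            u \in Std_reg e p mu la -> reg' e p t = reg' e p u -> t = u &
          forall s : tableau, s \in DStd e p mu ->
            exists2 t : tableau, t \in Std_reg e p mu la & reg' e p t = s],
      (* (ii) *)
      forall t : tableau, t \in Std_reg e p mu la ->
        res_seq e (reg' e p t) = res_seq e t &
      (* (iii), where r_{e,p,la,mu} is r_e(t0) for any t0 *)
      forall t0 : tableau, t0 \in Std_reg e p mu la ->
        ch e n (Std_reg e p mu la) =
        ((q ^+ r_tab e t0) *: ch e n (DStd e p mu))%R].
Proof.
have [c1 [c2 [hc Ec Ela]]] := Par2_two_col hla.
have [d1 [d2 [hd Ed Emu]]] := Par2_two_col hmu.1.
have E : c1 + c2 = d1 + d2 by rewrite Ec Ed.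
have positive p' : 1 < p' -> (exists t, t \in Std_reg e p' mu la) ->
  [/\ [/\ forall t, t \in Std_reg e p' mu la -> reg' e p' t \in DStd e p' mu,
          forall t u, t \in Std_reg e p' mu la ->
            u \in Std_reg e p' mu la -> reg' e p' t = reg' e p' u -> t = u &
          forall s, s \in DStd e p' mu ->
            exists2 t, t \in Std_reg e p' mu la & reg' e p' t = s],
      forall t, t \in Std_reg e p' mu la ->
        res_seq e (reg' e p' t) = res_seq e t &
      forall t0, t0 \in Std_reg e p' mu la ->
        ch e n (Std_reg e p' mu la) =
        ((q ^+ r_tab e t0) *: ch e n (DStd e p' mu))%R].
  rewrite Ela Emu => p1 [t0 h0]; split; first split.
  - exact: reg'_DStd.
  - exact: reg'_inj.
  - by move=> s; apply: reg'_surj h0.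
  - by move=> t /(reg'_res_deg he p1 hc hd E)[].
  - exact: ch_reg'.
case: hp => [p0|[/prime_gt1 p1 _]]; last exact: positive.
(* take [n + 2] in place of 0 *)
subst p.
have P la' t : Par2 n la' -> t \in Std la' -> is_path n (path_of t).
  by move=> /Par2_two_col[b1 [b2 [hb <- ->]]] /(Std_path hb)[].
have regE t : is_path n (path_of t) -> regT e 0 t = regT e n.+2 t.
  by move=> Pt; rewrite /regT (reg_ep_char0 he Pt).
have S : Std_reg e 0 mu la = Std_reg e n.+2 mu la.
  by apply: eq_in_filter => t /(P _ _ hla) /regE ->.
have D : DStd e 0 mu = DStd e n.+2 mu.
  by apply: eq_in_filter => t /(P _ _ hmu.1) /regE ->.
have R t : t \in Std_reg e n.+2 mu la -> reg' e 0 t = reg' e n.+2 t.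
  by rewrite mem_filter => /andP[_ /(P _ _ hla)]; apply: reg'_char0.
rewrite S D in hne *; have [[h1 h2 h3] h4 h5] := positive n.+2 isT hne.
split; first split.
- by move=> t ht; rewrite (R t ht); apply: h1.
- by move=> t u ht hu; rewrite (R t ht) (R u hu); apply: h2.
- by move=> s /h3[t ht <-]; exists t; rewrite ?(R t ht).
- by move=> t ht; rewrite (R t ht); apply: h4.
- exact: h5.
Qed.
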